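(* Let $d>2$ be an integer and $\Phi>0$. Let $\Omega\subset\mathbb R^d$ be an unbounded domain whose boundary $\partial\Omega$ is a compact connected hypersurface, and suppose that $U:\Omega\to\mathbb R$ satisfies $\nabla^2U=0$ in $\Omega$ and has the asymptotic behavior $$U(\boldsymbol r)\sim\frac{\Phi}{d(d-2)\pi^{d/2}|\boldsymbol r|^{d-2}}\int_0^\infty t^{d/2}e^{-t}\,\mathrm dt\qquad\text{as } |\boldsymbol r|\to+\infty .$$ If one equipotential surface of $U$ in $\Omega$ is a hypersphere centered at $\boldsymbol r_0\in\mathbb R^d$, then $$U(\boldsymbol r)=\frac{\Phi}{d(d-2)\pi^{d/2}|\boldsymbol r-\boldsymbol r_0|^{d-2}}\int_0^\infty t^{d/2}e^{-t}\,\mathrm dt\qquad\text{for all }\boldsymbol r\in\Omega .$$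
   Context: An equipotential surface of $U$ is a hypersurface contained in $\Omega$ that is a level set of $U$ (in particular $U$ is constant on it). *)

(* Defs.v *)
From HB Require Import structures.
From mathcomp Require Import all_boot all_order all_algebra.
From mathcomp Require Import all_classical all_reals all_analysis.

Set Implicit Arguments.
Unset Strict Implicit.
Unset Printing Implicit Defensive.

Import Order.TTheory GRing.Theory Num.Theory.
Import numFieldNormedType.Exports.

Local Open Scope classical_set_scope.
Local Open Scope ring_scope.

(* The library norm on 'rV[R]_d is the sup norm: it induces the usual topology
   and the usual bounded sets, but distances need the Euclidean norm. *)
Definition enorm (R : realType) (d : nat) (r : 'rV[R]_d) : R :=
  Num.sqrt (\sum_(i < d) r ord0 i ^+ 2).

Definition hypersphere (R : realType) (d : nat) (c : 'rV[R]_d) (rho : R) :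
    set 'rV[R]_d :=
  [set r | enorm (r - c) = rho].

Definition at_infinity (R : realType) (d : nat) : set_system 'rV[R]_d :=
  filter_from setT (fun M : R => [set r | M < enorm r]).

Global Instance at_infinity_filter (R : realType) (d : nat) :
  Filter (@at_infinity R d).
Proof.
apply: filter_from_filter; first by exists 0.
move=> M N _ _; exists (Num.max M N) => // r /=.
by rewrite gt_max => /andP[].
Qed.

Canonical at_infinity_filter_on (R : realType) (d : nat) :=
  FilterType (@at_infinity R d) (@at_infinity_filter R d).

Definition domain (R : realType) (d : nat) (A : set 'rV[R]_d) : Prop :=
  [/\ open A, connected A & A !=set0].

Definition boundary (T : topologicalType) (A : set T) : set T :=
  closure A `\` A°.

Definition homeomorphic_sets (S T : topologicalType) (A : set S) (B : set T) :
    Prop :=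
  exists (f : S -> T) (g : T -> S),
    [/\ {within A, continuous f}, {within B, continuous g},
        f @` A `<=` B, g @` B `<=` A &
        {in A, cancel f g} /\ {in B, cancel g f}].

(* No regularity is imposed: every C^k or smooth embedded hypersurface
   satisfies this definition. *)
Definition hypersurface (R : realType) (d : nat) (S : set 'rV[R]_d) : Prop :=
  S !=set0 /\
  forall p, S p -> exists (V : set 'rV[R]_d) (W : set 'rV[R]_d.-1),
    [/\ open V, V p, open W & homeomorphic_sets (S `&` V) W].

Definition partial (R : realType) (d : nat) (i : 'I_d) (U : 'rV[R]_d -> R) :
    'rV[R]_d -> R :=
  'D_(delta_mx ord0 i) U.

Definition C1_on (R : realType) (d : nat) (A : set 'rV[R]_d)
    (U : 'rV[R]_d -> R) : Prop :=
  forall r, A r -> {for r, continuous U} /\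
    forall i, derivable U r (delta_mx ord0 i) /\
              {for r, continuous (partial i U)}.

Definition C2_on (R : realType) (d : nat) (A : set 'rV[R]_d)
    (U : 'rV[R]_d -> R) : Prop :=
  C1_on A U /\ forall i, C1_on A (partial i U).

Definition laplacian (R : realType) (d : nat) (U : 'rV[R]_d -> R) :
    'rV[R]_d -> R :=
  fun r => \sum_(i < d) partial i (partial i U) r.

(* A function on an open set A is represented by a total function; every
   condition below then depends only on its values on A. *)
Definition harmonic_on (R : realType) (d : nat) (A : set 'rV[R]_d)
    (U : 'rV[R]_d -> R) : Prop :=
  C2_on A U /\ forall r, A r -> laplacian U r = 0.

Definition equipotential_surface (R : realType) (d : nat)
    (A : set 'rV[R]_d) (U : 'rV[R]_d -> R) (S : set 'rV[R]_d) : Prop :=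
  [/\ hypersurface S, S `<=` A & exists c, S = [set r | A r /\ U r = c]].

(* The integral is Gamma (d / 2 + 1), so this is Phi / ((d - 2) omega |r| ^ (d - 2))
   with omega the area of the unit sphere of R^d.  The value at r = 0 is the junk
   value of the division by 0. *)
Definition point_potential (R : realType) (d : nat) (Phi : R)
    (r : 'rV[R]_d) : R :=
  Phi / (d%:R * (d - 2)%:R * pi `^ (d%:R / 2) * enorm r ^+ (d - 2)) *
  \int[lebesgue_measure]_(t in `[0, +oo[) (t `^ (d%:R / 2) * expR (- t)).

(* Main.v *)
(** By connectedness the boundary of [Omega] lies on one side of the sphere.  If
    it lay outside, [U] would be constant in the ball by the maximum principle,
    so the sphere would not be a whole level set.  Hence the exterior of the
    sphere lies in [Omega]; there [U] is a multiple of
    [|r - r0| ^ (2 - d)] by the maximum principle, the asymptotics fix the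
    constant, and unique continuation extends the formula to [Omega], which
    cannot contain [r0] because [U] would blow up there.

    Unique continuation is derived from the maximum principle alone: comparison
    with a barrier bounds the differences [u (x + s e_i) - u (x - s e_i)];
    iterating gives bounds of analytic type on finite differences of all
    orders, so a harmonic function vanishing on half of a short coordinate
    segment vanishes at its end. *)

Require Import Defs.
From mathcomp Require Import all_boot all_order all_algebra.
From mathcomp Require Import all_classical all_reals all_analysis.
From mathcomp Require Import ring lra.

Set Implicit Arguments.
Unset Strict Implicit.
Unset Printing Implicit Defensive.

Import Order.TTheory GRing.Theory Num.Theory.
Import numFieldNormedType.Exports.

Local Open Scope classical_set_scope.
Local Open Scope ring_scope.

(** * Second derivatives on coordinate lines *)

(** Encoded as a relation carrying the value, so that sums, multiples and reflections can be
    computed without separate derivability conditions. *)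
Definition second_derivative_at0 (R : realType) (phi : R -> R) (a : R) : Prop :=
  exists2 psi : R -> R,
    \forall t \near (0 : R), is_derive (t : R) 1 phi (psi t) & is_derive (0 : R) 1 psi a.

(** Were [a] positive, [psi], which is zero at 0 by Fermat's rule, would be positive just to the
    right of 0, and the mean value theorem would give [phi m > phi 0]. *)
Lemma second_derivative_at0_le0 (R : realType) (phi : R -> R) (a : R) :
  second_derivative_at0 phi a -> (\forall t \near (0 : R), phi t <= phi 0) -> a <= 0.
Proof.
move=> [psi dphi dpsi] mx; rewrite leNgt; apply/negP => a0.
have [e /= e0 He] : \forall t \near (0 : R), is_derive (t : R) 1 phi (psi t) /\ phi t <= phi 0.
  exact: filterI dphi mx.
have {}He (t : R) : `|t| < e -> is_derive t 1 phi (psi t) /\ phi t <= phi 0.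
  by move=> te; apply: He; rewrite /= sub0r normrN.
have psi0 : psi 0 = 0.
  have He' (t : R) : t \in `]-e, e[ -> is_derive t 1 phi (psi t) /\ phi t <= phi 0.
    by move=> te; apply: He; rewrite ltr_norml; move: te; rewrite in_itv.
  have z : (0 : R) \in `]-e, e[ by rewrite in_itv/= oppr_lt0 e0.
  have h : is_derive (0 : R) 1 phi 0.
    apply: (@derive1_at_max _ phi (-e) e) => //; first by lra.
      by move=> t /He' [[]].
    by move=> t /He' [].
  have [h1 _] := He' _ z.
  by rewrite -(@derive_val _ _ _ _ _ _ _ h1) (@derive_val _ _ _ _ _ _ _ h).
have : \forall h \near (0 : R)^', 0 < h^-1 * psi h.
  have [ex val] := dpsi.
  have : h^-1 *: (psi (h *: 1 + 0) - psi 0) @[h --> (0 : R)^'] --> a.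
    by rewrite -val; exact: ex.
  move=> /cvgr_gt -/(_ _ a0); apply: filterS => h.
  by rewrite psi0 subr0 addr0 /GRing.scale /= mulr1.
move=> [e' /= e'0 He'].
pose m := Num.min e e' / 2.
have mm : 0 < Num.min e e' by rewrite lt_min e0.
have m0 : 0 < m by rewrite divr_gt0.
have [me me'] : m < e /\ m < e'.
  have mlt : m < Num.min e e' by rewrite /m; lra.
  by move: mlt; rewrite lt_min => /andP[].
have [c] : exists2 c, c \in `]0, m[ & phi m - phi 0 = psi c * (m - 0).
  apply: MVT => //.
    move=> x; rewrite in_itv/= => /andP[x0 xm].
    by apply: (He x _).1; rewrite gtr0_norm// (lt_trans xm).
  apply: derivable_within_continuous => x; rewrite in_itv/= => /andP[x0 xm].
  have [|[]//] := He x.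
  by rewrite ger0_norm// (le_lt_trans xm).
rewrite in_itv/= subr0 => /andP[c0 cm] E.
have : 0 < psi c.
  rewrite -(@pmulr_rgt0 _ c^-1) ?invr_gt0//; apply: He'; last by rewrite gt_eqF.
  by rewrite /= sub0r normrN gtr0_norm// (lt_trans cm).
move=> /mulr_gt0 /(_ m0); rewrite -E subr_gt0 ltNge.
by rewrite (He m _).2// gtr0_norm.
Qed.

Lemma second_derivative_at0D (R : realType) (phi phi' : R -> R) (a a' : R) :
  second_derivative_at0 phi a -> second_derivative_at0 phi' a' ->
  second_derivative_at0 (fun t => phi t + phi' t) (a + a').
Proof.
move=> [psi d1 d2] [psi' d1' d2']; exists (fun t => psi t + psi' t).
  near=> t.
  by apply: is_deriveD; near: t.
exact: is_deriveD.
Unshelve. all: by end_near. Qed.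

Lemma second_derivative_at0Z (R : realType) (k : R) (phi : R -> R) (a : R) :
  second_derivative_at0 phi a ->
  second_derivative_at0 (fun t => k * phi t) (k * a).
Proof.
move=> [psi d1 d2]; exists (fun t => k * psi t).
  by near=> t; apply: is_deriveZ; near: t.
exact: is_deriveZ.
Unshelve. all: by end_near. Qed.

Lemma second_derivative_at0_reflect (R : realType) (phi : R -> R) (a : R) :
  second_derivative_at0 phi a ->
  second_derivative_at0 (fun t => phi (- t)) a.
Proof.
have chain (f : R -> R) (t b : R) :
    is_derive (- t) 1 f b -> is_derive t 1 (fun t => f (- t)) (- b).
  move=> df.
  have h := @is_derive1_comp _ f (fun t => - t) t b (-1).
  by rewrite -mulrN1; apply: h.
move=> [psi d1 d2]; exists (fun t => - psi (- t)).
  have [e /= e0 He] := d1; exists e => // t /= te.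
  by apply: chain; apply: He; rewrite /= opprK add0r -normrN -[- t]add0r.
have := @is_deriveN _ _ _ (fun t => psi (- t)) 0 1 (- a).
by rewrite opprK; apply; apply: chain; rewrite oppr0.
Qed.

Lemma second_derivative_at0_quadratic (R : realType) (a b c : R) :
  second_derivative_at0 (fun t => a + b * t + c * t ^+ 2) (2 * c).
Proof.
exists (fun t => b + 2 * c * t).
  near=> t.
  apply: is_derive_eq.
  rewrite /GRing.scale/=; lra.
apply: is_derive_eq.
by rewrite /GRing.scale/=; lra.
Unshelve. all: by end_near. Qed.

(** * Maximum principle *)

(* Only pure second derivatives along coordinate lines are required, so the
   notion is stable under reflections and finite differences without any
   [C^2] bookkeeping, and it suffices for the maximum principle. *)
Definition laplacian_at (R : realType) (d : nat) (g : 'rV[R]_d -> R)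
    (y : 'rV[R]_d) (L : R) : Prop :=
  exists2 a : 'I_d -> R,
    forall i, second_derivative_at0 (fun t => g (y + t *: delta_mx ord0 i)) (a i)
    & \sum_(i < d) a i = L.

Section laplacian_at.
Context (R : realType) (d : nat).
Implicit Types (g h : 'rV[R]_d -> R) (x y : 'rV[R]_d).

Lemma laplacian_atD g h y L L' : laplacian_at g y L -> laplacian_at h y L' ->
  laplacian_at (fun x => g x + h x) y (L + L').
Proof.
move=> [a Ha <-] [b Hb <-]; exists (fun i => a i + b i); last by rewrite big_split.
by move=> i; exact: second_derivative_at0D.
Qed.

Lemma laplacian_atZ (k : R) g y L : laplacian_at g y L ->
  laplacian_at (fun x => k * g x) y (k * L).
Proof.
move=> [a Ha <-]; exists (fun i => k * a i); last by rewrite big_distrr.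
by move=> i; exact: second_derivative_at0Z.
Qed.

Lemma laplacian_at_translate g y v L : laplacian_at g (y + v) L ->
  laplacian_at (fun x => g (x + v)) y L.
Proof.
move=> [a Ha <-]; exists a => // i.
have := Ha i; congr (second_derivative_at0 _ _).
by apply/funext => t; rewrite addrAC.
Qed.

Lemma second_derivative_at0_cst (c : R) : second_derivative_at0 (fun=> c) 0.
Proof.
have := second_derivative_at0_quadratic c 0 0; rewrite mulr0.
by congr (second_derivative_at0 _ _); apply/funext => t; rewrite !mul0r !addr0.
Qed.

(** Along the [i]-th coordinate line only the [i]-th summand moves. *)
Lemma laplacian_at_separable (f : 'I_d -> R -> R) (a : 'I_d -> R) y :
  (forall j, second_derivative_at0 (fun t => f j (y ord0 j + t)) (a j)) ->
  laplacian_at (fun x => \sum_(j < d) f j (x ord0 j)) y (\sum_(j < d) a j).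
Proof.
move=> H; exists a => // i.
have := second_derivative_at0D (H i)
  (second_derivative_at0_cst (\sum_(j < d | j != i) f j (y ord0 j))).
rewrite addr0; congr (second_derivative_at0 _ _); apply/funext => t.
rewrite [RHS](bigD1 i)//= !mxE !eqxx mulr1; congr (_ + _).
by apply: eq_bigr => j ji; rewrite !mxE (negPf ji) mulr0 addr0.
Qed.

Definition reflect_coord (i : 'I_d) (c : R) (y : 'rV[R]_d) : 'rV[R]_d :=
  \row_j (if j == i then 2 * c - y ord0 j else y ord0 j).

Lemma laplacian_at_reflect (i : 'I_d) (c : R) g y L :
  laplacian_at g (reflect_coord i c y) L ->
  laplacian_at (fun x => g (reflect_coord i c x)) y L.
Proof.
move=> [a Ha <-]; exists a => // j.
have := Ha j; have [->|ji] := eqVneq j i.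
  move=> /second_derivative_at0_reflect; congr (second_derivative_at0 _ _).
  apply/funext => t; congr g; apply/rowP => k; rewrite !mxE.
  have [->|ki] := eqVneq k i; first by rewrite eqxx; ring.
  by rewrite !(mulr0,addr0).
congr (second_derivative_at0 _ _); apply/funext => t; congr g.
apply/rowP => k; rewrite !mxE.
have [->|//] := eqVneq k i.
by rewrite [i == j]eq_sym (negPf ji) !mulr0 !addr0.
Qed.

Lemma cvg_line (i : 'I_d) y :
  y + t *: delta_mx ord0 i @[t --> (0 : R)] --> y.
Proof.
rewrite -[X in _ --> X]addr0; apply: cvgD; first exact: cvg_cst.
rewrite -[X in _ --> X](scale0r (delta_mx ord0 i)).
by apply: cvgZr_tmp; exact: cvg_id.
Qed.

(** At a positive maximum over [K], which is then interior, all second derivatives along coordinate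
    lines are nonpositive, so they cannot add up to [L > 0]. *)
Lemma subharmonic_le0 (K : set 'rV[R]_d) g :
  compact K -> {within K, continuous g} ->
  (forall y, K y -> g y <= 0 \/ (K° y /\ exists2 L, 0 < L & laplacian_at g y L)) ->
  forall y, K y -> g y <= 0.
Proof.
move=> cK cg H y0 Ky0.
have [y] := @EVT_max_rV R d g K (ex_intro _ _ Ky0) cK cg.
rewrite inE => Ky mx; rewrite leNgt; apply/negP => gy0.
have gle z : K z -> g z <= g y by move=> Kz; apply: mx; rewrite inE.
have [|[Kiy [L L0 [a Ha aL]]]] := H _ Ky.
  by rewrite leNgt (lt_le_trans gy0)// gle.
suff : \sum_(i < d) a i <= 0 by rewrite aL leNgt L0.
apply: sumr_le0 => i _; apply: second_derivative_at0_le0 (Ha i) _.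
have : \forall t \near (0 : R), K (y + t *: delta_mx ord0 i).
  exact: (cvg_line i Kiy).
by apply: filterS => t; rewrite scale0r addr0; exact: gle.
Qed.

Lemma continuous_coord_sum (f : 'I_d -> R -> R) : (forall j, continuous (f j)) ->
  continuous (fun x : 'rV[R]_d => \sum_(j < d) f j (x ord0 j)).
Proof.
move=> cf x.
apply: (@cvg_big _ _ +%R 0 xpredT _ _ (nbhs x) _ _ _ (nbhs_filter x)).
  exact: add_continuous.
move=> j _; apply: (@continuous_comp _ _ _ (fun x : 'rV[R]_d => x ord0 j)).
  exact: coord_continuous.
exact: cf.
Qed.

(** Adding a small multiple of [q - q yM], with [q] the squared Euclidean norm, makes the Laplacian
    positive and raises no value on [K]. *)
Lemma max_principle (K : set 'rV[R]_d) g : (0 < d)%N ->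
  compact K -> {within K, continuous g} ->
  (forall y, K y -> g y <= 0 \/ (K° y /\ laplacian_at g y 0)) ->
  forall y, K y -> g y <= 0.
Proof.
move=> d0 cK cg H y Ky.
pose q (x : 'rV[R]_d) := \sum_(j < d) (x ord0 j) ^+ 2.
have cq : continuous q.
  by apply: (@continuous_coord_sum (fun=> fun s => s ^+ 2)) => _; exact: exprn_continuous.
have [yM] := @EVT_max_rV R d q K (ex_intro _ _ Ky) cK (continuous_subspaceT cq).
rewrite inE => KyM mx.
have qle z : K z -> q z <= q yM by move=> Kz; apply: mx; rewrite inE.
have lq z : laplacian_at q z (\sum_(j < d) 2).
  apply: (@laplacian_at_separable (fun=> fun s => s ^+ 2) (fun=> 2)) => j.
  have := second_derivative_at0_quadratic (z ord0 j ^+ 2) (2 * z ord0 j) 1.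
  by rewrite mulr1; congr (second_derivative_at0 _ _); apply/funext => t; ring.
have main (e : R) : 0 < e -> g y + e * (q y + (- q yM)) <= 0.
  move=> e0; apply: (@subharmonic_le0 K (fun z => g z + e * (q z + (- q yM)))) => //.
    move=> z; apply: cvgD; first exact: cg.
    move: z; apply: continuous_subspaceT => x.
    apply: (@continuousM _ _ (fun=> e) (fun z => q z + - q yM)).
      exact: cst_continuous.
    by apply: continuousD; [exact: cq|exact: cst_continuous].
  move=> z Kz; have [gz|[Kiz lg]] := H _ Kz.
    left; rewrite (le_trans _ gz)// gerDl mulr_ge0_le0// ?(ltW e0)//.
    by rewrite subr_le0 qle.
  right; split => //; exists (0 + e * (\sum_(j < d) 2 + 0)).
    rewrite add0r addr0 mulr_gt0// sumr_const card_ord.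
    by rewrite pmulrn_lgt0.
  apply: laplacian_atD => //; apply: laplacian_atZ; apply: laplacian_atD => //.
  by exists (fun=> 0) => [i|]; [exact: second_derivative_at0_cst|rewrite big1].
rewrite leNgt; apply/negP => gy0.
(* With this [e] the correction [e * (q yM - q y)] stays below half of [g y]. *)
have /main : 0 < g y / (2 * (q yM - q y + 1)).
  by rewrite divr_gt0// mulr_gt0// ltr_wpDl// subr_ge0 qle.
have P : 0 < q yM - q y + 1 by rewrite ltr_wpDl// subr_ge0 qle.
rewrite leNgt => /negP; apply.
have -> : g y + g y / (2 * (q yM - q y + 1)) * (q y - q yM) =
  (g y * (q yM - q y + 2)) / (2 * (q yM - q y + 1)) by field; lra.
by rewrite divr_gt0 ?mulr_gt0//; lra.
Qed.

End laplacian_at.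

(** * Reflection estimate *)

(** Continuity is a separate clause because [laplacian_at] sees only the coordinate lines through
    [y]. *)
Definition harmonic_at (R : realType) (d : nat) (u : 'rV[R]_d -> R)
    (y : 'rV[R]_d) : Prop :=
  {for y, continuous u} /\ laplacian_at u y 0.

Section difference.
Context (R : realType) (d : nat).
Implicit Types (u v : 'rV[R]_d -> R) (x y : 'rV[R]_d).

Lemma harmonic_atD u v y : harmonic_at u y -> harmonic_at v y ->
  harmonic_at (fun x => u x + v x) y.
Proof.
move=> [cu lu] [cv lv]; split; first exact: continuousD.
by have := laplacian_atD lu lv; rewrite addr0.
Qed.

Lemma harmonic_atZ (k : R) u y : harmonic_at u y ->
  harmonic_at (fun x => k * u x) y.
Proof.
move=> [cu lu]; split; last by have := laplacian_atZ k lu; rewrite mulr0.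
by apply: (@continuousM _ _ (fun=> k) u) => //; exact: cst_continuous.
Qed.

Lemma harmonic_at_cst (k : R) y : harmonic_at (fun=> k) y.
Proof.
split; first exact: cst_continuous.
by exists (fun=> 0) => [i|]; [exact: second_derivative_at0_cst|rewrite big1].
Qed.

Lemma harmonic_at_translate u y (v : 'rV[R]_d) : harmonic_at u (y + v) ->
  harmonic_at (fun x => u (x + v)) y.
Proof.
move=> [cu lu]; split; last exact: laplacian_at_translate.
apply: (@continuous_comp _ _ _ (fun x : 'rV[R]_d => x + v)) => //.
by apply: continuousD; [exact: cvg_id|exact: cst_continuous].
Qed.

Lemma continuous_reflect_coord (i : 'I_d) (c : R) : continuous (@reflect_coord R d i c).
Proof.
have E z : reflect_coord i c z = z + (2 * (c - z ord0 i)) *: delta_mx ord0 i.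
  apply/rowP => j; rewrite !mxE /=; have [->|ji] := eqVneq j i.
    by rewrite ?eqxx /=; ring.
  by rewrite mulr0 addr0.
have cs : continuous (fun z : 'rV[R]_d => 2 * (c - z ord0 i)).
  move=> y; apply: (@continuousM _ _ (fun=> 2) (fun z : 'rV[R]_d => c - z ord0 i)).
    exact: cst_continuous.
  by apply: (@continuousB _ _ _ (fun=> c) (fun z : 'rV[R]_d => z ord0 i));
    [exact: cst_continuous|exact: coord_continuous].
rewrite (funext E) => y.
apply: (@continuousD _ _ _ id
  (fun z : 'rV[R]_d => (2 * (c - z ord0 i)) *: delta_mx ord0 i)); first exact: cvg_id.
exact: (cvgZr_tmp (cs y)).
Qed.

Lemma harmonic_at_reflect (i : 'I_d) (c : R) u y :
  harmonic_at u (reflect_coord i c y) ->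
  harmonic_at (fun x => u (reflect_coord i c x)) y.
Proof.
move=> [cu lu]; split; last exact: laplacian_at_reflect.
by apply: continuous_comp => //; exact: continuous_reflect_coord.
Qed.

Lemma within_continuous_at (K : set 'rV[R]_d) u :
  (forall y, K y -> {for y, continuous u}) -> {within K, continuous u}.
Proof.
by move=> H; apply: continuous_in_subspaceT => y; rewrite inE; exact: H.
Qed.

Lemma interior_box (lo hi : 'I_d -> R) y :
  (forall j, lo j < y ord0 j < hi j) ->
  [set z : 'rV[R]_d | forall j, lo j <= z ord0 j <= hi j]° y.
Proof.
move=> H; apply: (@filter_forall _ _
  (fun j (z : 'rV[R]_d) => lo j <= z ord0 j <= hi j) (nbhs y) (nbhs_filter y)) => j.
have /near_in_itvoo lohi : y ord0 j \in `]lo j, hi j[ by rewrite in_itv; exact: H.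
have : nbhs (y ord0 j) [set t | lo j <= t <= hi j].
  by apply: filterS lohi => z; rewrite in_itv/= => /andP[/ltW -> /ltW ->].
exact: coord_continuous.
Qed.

Lemma compact_box (lo hi : 'I_d -> R) :
  compact [set z : 'rV[R]_d | forall j, lo j <= z ord0 j <= hi j].
Proof.
have := @rV_compact _ _ (fun j => `[lo j, hi j]%classic) (fun j => @segment_compact _ _ _).
congr compact; apply/seteqP; split => z /= H j; have := H j; by rewrite in_itv.
Qed.

(* On the half cube [0 <= y_i - x_i <= r], the odd part of [u] in the
   coordinate [i] vanishes on the flat face and is dominated by the harmonic
   barrier [2 M (\sum_(j != i) z_j ^ 2 + d z_i - (d - 1) z_i ^ 2)], where
   [z = (y - x) / r]. *)
Lemma reflection_estimate (i : 'I_d) u x (r M s : R) : 0 < r -> 0 <= s <= r ->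
  (forall y, (forall j, x ord0 j - r <= y ord0 j <= x ord0 j + r) ->
     harmonic_at u y /\ `|u y| <= M) ->
  u (x + s *: delta_mx ord0 i) - u (x - s *: delta_mx ord0 i) <=
    2 * d%:R * M * s / r.
Proof.
move=> r0 /andP[s0 sr] H.
have d0 : (0 < d)%N by case: (d) i => // -[].
have d1 : 1 <= d%:R :> R by rewrite ler1n.
have M0 : 0 <= M.
  have [|_] := H x; last exact: le_trans.
  by move=> j; rewrite gerBl lerDl ltW.
pose lo j := if j == i then x ord0 j else x ord0 j - r.
pose hi j := x ord0 j + r.
pose K := [set z : 'rV[R]_d | forall j, lo j <= z ord0 j <= hi j].
pose ga j : R := if j == i then d%:R else 0.
pose al j : R := if j == i then 1 - d%:R else 1.
pose f j t : R := 2 * M * (ga j * ((t - x ord0 j) / r) + al j * ((t - x ord0 j) / r) ^+ 2).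
pose b (y : 'rV[R]_d) := \sum_(j < d) f j (y ord0 j).
have cb : continuous b.
  apply: continuous_coord_sum => j.
  have -> : f j = horner ((2 * M) *: (ga j *: (r^-1 *: ('X - (x ord0 j)%:P))
      + al j *: (r^-1 *: ('X - (x ord0 j)%:P)) ^+ 2)).
    by apply/funext => t; rewrite /f !(hornerE, horner_exp) /=; ring.
  exact: continuous_horner.
have lb y : harmonic_at b y.
  split; first exact: cb.
  have -> : (0 : R) = \sum_(j < d) (2 * (2 * M * al j / r ^+ 2)).
    rewrite -big_distrr/= -big_distrl/= -big_distrr/=.
    suff -> : \sum_(j < d) al j = 0 by rewrite !(mulr0,mul0r).
    rewrite (bigD1 i)//= {1}/al eqxx (eq_bigr (fun=> 1)) => [|j /negPf]; last by rewrite /al => ->.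
    rewrite sumr_const cardC1 card_ord; case: (d) d0 => // d' _ /=.
    by rewrite -addn1 natrD; ring.
  apply: laplacian_at_separable => j.
  set t0 := (y ord0 j - x ord0 j).
  have := second_derivative_at0_quadratic (f j (y ord0 j))
    (2 * M * (ga j / r + 2 * al j * t0 / r ^+ 2)) (2 * M * al j / r ^+ 2).
  congr (second_derivative_at0 _ _); apply/funext => t; rewrite /f /t0.
  by field; lra.
have inc y : K y -> forall j, x ord0 j - r <= y ord0 j <= x ord0 j + r.
  by move=> Ky j; have := Ky j; rewrite /lo /hi; case: ifP => _; lra.
have inr y : K y -> forall j, x ord0 j - r <= reflect_coord i (x ord0 i) y ord0 j <= x ord0 j + r.
  move=> Ky j; have := Ky j; rewrite /lo /hi !mxE; case: eqP => [->|_]; lra.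
have f_ge0 y j : K y -> 0 <= f j (y ord0 j).
  move=> /(_ j); rewrite /lo /hi /f /ga /al => yj.
  rewrite mulr_ge0// ?mulr_ge0//.
  case: eqP yj => ji yj; last by rewrite mul0r add0r mul1r sqr_ge0.
  have z0 : 0 <= (y ord0 j - x ord0 j) / r by rewrite divr_ge0//; lra.
  have z1 : (y ord0 j - x ord0 j) / r <= 1 by rewrite ler_pdivrMr// mul1r; lra.
  move: z0 z1; set z := _ / r => z0 z1.
  have -> : d%:R * z + (1 - d%:R) * z ^+ 2 = z + (d%:R - 1) * (z * (1 - z)) by ring.
  by apply: addr_ge0 => //; apply: mulr_ge0; [lra|apply: mulr_ge0 => //; lra].
have b_ge y j : K y -> f j (y ord0 j) <= b y.
  move=> Ky; rewrite /b (bigD1 j)//= lerDl; apply: sumr_ge0 => k _; exact: f_ge0.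
have key y : K y -> u y + (- 1 * u (reflect_coord i (x ord0 i) y) + (-1) * b y) <= 0.
  have cK : compact K by exact: compact_box.
  move: y; apply: max_principle => //.
    apply: within_continuous_at => y Ky.
    apply: (harmonic_atD (H _ (inc _ Ky)).1 _).1.
    apply: harmonic_atD; apply: harmonic_atZ => //.
    exact: (harmonic_at_reflect (H _ (inr _ Ky)).1).
  move=> y Ky.
  have [hu uM] := H _ (inc _ Ky).
  have [hu' uM'] := H _ (inr _ Ky).
  have [E|NE] := pselect (forall j, lo j < y ord0 j < hi j).
    right; split; first exact: interior_box.
    apply: (harmonic_atD hu _).2; apply: harmonic_atD; apply: harmonic_atZ => //.
    exact: harmonic_at_reflect.
  left; have [j yj] := (existsNP _).2 NE.
  (* On the flat face the reflection fixes [y], so the odd part vanishes; on every other face a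
     single term of the barrier already reaches [2 * M]. *)
  have [[ji yx]|fj] : (j = i /\ y ord0 i = x ord0 i) \/ 2 * M <= f j (y ord0 j).
    have := Ky j; move: yj; rewrite /lo /hi /f /ga /al.
    have [-> yi Kyi|ji yi Kyi] := eqVneq j i; last first.
      right; rewrite mul0r add0r mul1r ler_peMr ?mulr_ge0//.
      have [->|->] : y ord0 j = x ord0 j - r \/ y ord0 j = x ord0 j + r by lra.
        rewrite (_ : (_ / r) = -1); first by lra.
        by field; lra.
      rewrite (_ : (_ / r) = 1); first by lra.
      by field; lra.
    have [->|->] : y ord0 i = x ord0 i \/ y ord0 i = x ord0 i + r by lra.
      by left.
    right; rewrite ler_peMr ?mulr_ge0//.
    rewrite (_ : (_ / r) = 1); first by lra.
    by field; lra.
    have -> : reflect_coord i (x ord0 i) y = y.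
      apply/rowP => k; rewrite !mxE; case: eqP => // ->; rewrite yx; ring.
    have := b_ge y j Ky; have := f_ge0 y j Ky; lra.
  have := b_ge y j Ky; move: uM uM'; rewrite !ler_norml; lra.
have Ks : K (x + s *: delta_mx ord0 i).
  move=> j; rewrite !mxE /= /lo /hi; case: eqP => _; rewrite /= ?(mulr1,mulr0); lra.
have := key _ Ks.
have -> : reflect_coord i (x ord0 i) (x + s *: delta_mx ord0 i) = x - s *: delta_mx ord0 i.
  apply/rowP => j; rewrite !mxE /=.
  by case: eqP => [->|_]; rewrite /= ?(mulr1,mulr0); ring.
have : b (x + s *: delta_mx ord0 i) <= 2 * d%:R * M * s / r.
  rewrite /b (bigD1 i)//= big1 ?addr0; last first.
    move=> j ji; rewrite !mxE (negPf ji) mulr0 addr0 /f subrr; ring.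
  rewrite !mxE !eqxx mulr1 /f /ga /al eqxx addrAC subrr add0r.
  have : 0 <= M * (s / r) ^+ 2 * (d%:R - 1) by apply: mulr_ge0; [rewrite mulr_ge0// sqr_ge0|lra].
  by rewrite /=; lra.
lra.
Qed.

End difference.

(** * Unique continuation *)

Section continuation.
Context (R : realType) (d : nat).
Implicit Types (u v : 'rV[R]_d -> R) (p q x y : 'rV[R]_d).

(** For [0 < d] this is the open ball of the sup norm; the coordinates are exposed because
    continuation proceeds along one axis at a time. *)
Definition cube q (rho : R) : set 'rV[R]_d :=
  [set y | forall j, `|y ord0 j - q ord0 j| < rho].

Lemma cube_le q (r r' : R) : r <= r' -> cube q r `<=` cube q r'.
Proof. by move=> rr y Hy j; exact: lt_le_trans (Hy j) rr. Qed.

Lemma nbhs_cube q (P : set 'rV[R]_d) :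
  nbhs q P <-> exists2 e : R, 0 < e & cube q e `<=` P.
Proof.
split=> [/nbhs_ballP[e /= e0 He]|[e e0 He]].
  exists e => // y Hy; apply: He; split => // i j.
  by rewrite /ball/= ord1 distrC; exact: Hy.
apply/nbhs_ballP; exists e => //= y [_ Hy]; apply: He => j.
by rewrite distrC; exact: Hy.
Qed.

Lemma open_cube q (r : R) : open (cube q r).
Proof.
rewrite openE => y Hy; apply/nbhs_cube.
have [i0|ni] := pselect (exists i : 'I_d, True); last first.
  by exists 1 => // z _ j; case: ni; exists j.
have r0 : 0 < r by case: i0 => i _; exact: le_lt_trans (normr_ge0 _) (Hy i).
pose e := \big[Num.min/r]_(j < d) (r - `|y ord0 j - q ord0 j|).
have ee j : e <= r - `|y ord0 j - q ord0 j| by exact: bigmin_le.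
exists e.
  rewrite /e; elim/big_ind : _ => // [a b a0 b0|j _]; first by rewrite lt_min a0.
  by rewrite subr_gt0; exact: Hy.
move=> z Hz j; have := Hz j; have := ee j.
have := ler_distD (y ord0 j) (z ord0 j) (q ord0 j); lra.
Qed.

(** The one-sided estimate is applied to [u] and to its opposite; a negative [s] exchanges the two
    points. *)
Lemma central_difference_estimate (i : 'I_d) u x (r M s : R) : 0 < r -> `|s| <= r ->
  (forall y, (forall j, x ord0 j - r <= y ord0 j <= x ord0 j + r) ->
     harmonic_at u y /\ `|u y| <= M) ->
  `|u (x + s *: delta_mx ord0 i) - u (x - s *: delta_mx ord0 i)| <=
    2 * d%:R * M * `|s| / r.
Proof.
move=> r0; wlog s0 : s / 0 <= s => [wl|].
  have [s0|s0 sr] := lerP 0 s; first exact: wl.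
  move=> H; have := wl (- s); rewrite normrN distrC scaleNr opprK; apply => //.
  by rewrite oppr_ge0 ltW.
rewrite ger0_norm// => sr H; rewrite ler_norml; apply/andP; split; last first.
  by apply: reflection_estimate => //; rewrite s0.
have := @reflection_estimate R d i (fun y => -1 * u y) x r M s r0.
rewrite s0 sr => /(_ isT) h.
have : -1 * u (x + s *: delta_mx ord0 i) -
    -1 * u (x - s *: delta_mx ord0 i) <= 2 * d%:R * M * s / r.
  apply: h => y /H [h1 h2]; split; first exact: harmonic_atZ.
  by rewrite mulN1r normrN.
lra.
Qed.

Definition forward_difference (w : 'rV[R]_d) u y := u (y + w) - u y.

(** A forward difference of step [h] is a central difference of half step about the midpoint, around
    which a cube of radius [eta - |h| / 2] is available; [|h| <= eta] makes this at least
    [eta / 2]. *)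
Lemma forward_difference_estimate (i : 'I_d) u q (rho eta M h : R) :
  0 < eta -> `|h| <= eta ->
  (forall y, cube q rho y -> harmonic_at u y /\ `|u y| <= M) ->
  forall y, cube q (rho - eta) y ->
    harmonic_at (forward_difference (h *: delta_mx ord0 i) u) y /\
    `|forward_difference (h *: delta_mx ord0 i) u y| <= M * (2 * d%:R * `|h| / eta).
Proof.
move=> eta0 heta H y Hy.
have Hyh : cube q rho (y + h *: delta_mx ord0 i).
  move=> j; have := Hy j; rewrite !mxE /=.
  have h1 : `|h * (j == i)%:R| <= `|h|.
    by case: (j == i); rewrite ?mulr1// mulr0 normr0.
  have := ler_normD (y ord0 j - q ord0 j) (h * (j == i)%:R).
  by rewrite addrAC; lra.
have Hy' : cube q rho y by apply: cube_le Hy; lra.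
have M0 : 0 <= M by have [_] := H _ Hy'; exact: le_trans.
split.
  have h1 := harmonic_at_translate (H _ Hyh).1.
  have := harmonic_atD h1 (harmonic_atZ (-1) (H _ Hy').1).
  by congr harmonic_at; apply/funext => z; rewrite mulN1r.
pose x := y + (h / 2) *: delta_mx ord0 i.
have -> : forward_difference (h *: delta_mx ord0 i) u y =
    u (x + (h / 2) *: delta_mx ord0 i) - u (x - (h / 2) *: delta_mx ord0 i).
  rewrite /forward_difference /x addrK -addrA -scalerDl.
  by congr (u (_ + _ *: _) - _); lra.
have nh2 : `|h / 2| = `|h| / 2 by rewrite normrM [`|_^-1|]ger0_norm.
have r0 : 0 < eta - `|h| / 2 by lra.
apply: le_trans.
  apply: (@central_difference_estimate i u x (eta - `|h| / 2) M) => //.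
    by rewrite nh2; lra.
  move=> z Hz; apply: H => j; have := Hz j.
  have xj : `|x ord0 j - q ord0 j| <= `|y ord0 j - q ord0 j| + `|h| / 2.
    rewrite /x !mxE /= addrAC; apply: le_trans (ler_normD _ _) _.
    rewrite lerD2l -nh2.
    by case: (j == i); rewrite ?mulr1// mulr0 normr0.
  have := Hy j => yj zj.
  have zx : `|z ord0 j - x ord0 j| <= eta - `|h| / 2 by rewrite ler_norml; lra.
  have := ler_distD (x ord0 j) (z ord0 j) (q ord0 j); lra.
rewrite nh2 ler_pdivrMr//.
have -> : M * (2 * d%:R * `|h| / eta) * (eta - `|h| / 2) =
  2 * d%:R * M * (`|h| / 2) + (M * d%:R * `|h|) * ((eta - `|h|) / eta).
  by field; lra.
by rewrite lerDl mulr_ge0// ?divr_ge0 ?mulr_ge0 ?subr_ge0// ltW.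
Qed.

(** A discrete Cauchy estimate: each difference costs [eta] of the radius and gains one factor. With
    [h] and [eta] both of order [1 / m] the bound is geometric in [m]. *)
Lemma iter_forward_difference_estimate (i : 'I_d) u q (rho eta M h : R) (m : nat) :
  0 < eta -> `|h| <= eta ->
  (forall y, cube q rho y -> harmonic_at u y /\ `|u y| <= M) ->
  forall y, cube q (rho - m%:R * eta) y ->
    harmonic_at (iter m (forward_difference (h *: delta_mx ord0 i)) u) y /\
    `|iter m (forward_difference (h *: delta_mx ord0 i)) u y| <=
      M * (2 * d%:R * `|h| / eta) ^+ m.
Proof.
move=> eta0 heta H; elim: m => [|m IH] y.
  by rewrite mul0r subr0 expr0 mulr1; exact: H.
have -> : rho - m.+1%:R * eta = rho - m%:R * eta - eta by rewrite -addn1 natrD; ring.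
by rewrite exprSr (mulrA M); exact: (forward_difference_estimate i eta0 heta IH).
Qed.

(** Newton's forward formula writes the value at [y + n w] as a binomial combination of the
    differences at [y], and the coefficients add up to [2 ^+ n]. *)
Lemma line_differences (w : 'rV[R]_d) u y (n : nat) (B : R) :
  (forall j, (j <= n)%N -> `|iter j (forward_difference w) u y| <= B) ->
  `|u (y + n%:R *: w)| <= 2 ^+ n * B.
Proof.
elim: n u => [|n IH] u H.
  by rewrite scale0r addr0 mul1r; exact: (H 0).
have -> : u (y + n.+1%:R *: w) =
    forward_difference w u (y + n%:R *: w) + u (y + n%:R *: w).
  by rewrite /forward_difference subrK -natr1 scalerDl scale1r addrA.
have -> : 2 ^+ n.+1 * B = 2 ^+ n * B + 2 ^+ n * B by rewrite exprS; ring.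
apply: le_trans (ler_normD _ _) (lerD _ _); apply: IH => j jn.
  by rewrite -iterSr; exact: H.
by apply: H; exact: leqW.
Qed.

Lemma iter_forward_difference_eq0 (w : 'rV[R]_d) u y (j : nat) :
  (forall k, (k <= j)%N -> u (y + k%:R *: w) = 0) ->
  iter j (forward_difference w) u y = 0.
Proof.
elim: j u => [|j IH] u H; first by have := H 0; rewrite scale0r addr0; apply.
rewrite iterSr; apply: IH => k kj.
have := H k.+1 kj; rewrite -natr1 scalerDl scale1r addrA => E.
by rewrite /forward_difference E H ?subrr// leqW.
Qed.

Lemma le_half_powers_eq0 (M v : R) : (forall m, (0 < m)%N -> `|v| <= M / 2 ^+ m) -> v = 0.
Proof.
move=> H; apply/eqP/negPn/negP => v0.
have vp : 0 < `|v| by rewrite normr_gt0.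
have M0 : 0 <= M / `|v|.
  rewrite divr_ge0//; have := H 1 isT; rewrite expr1; lra.
have := archi_boundP M0; set m := Num.bound _ => Mm.
have := H m.+1 isT; rewrite ler_pdivlMr ?exprn_gt0// mulrC -ler_pdivlMr//.
apply/negP; rewrite -ltNge; apply: lt_le_trans Mm _.
by rewrite -natrX ler_nat ltnW// ltnW// ltn_expl.
Qed.

(* The [j]-th differences at [x0] vanish for [j] below half of the number of
   steps; analyticity bounds the remaining ones geometrically. *)
Lemma segment_continuation (i : 'I_d) u q x0 (rho M l : R) :
  0 < rho -> 32 * d%:R * `|l| <= rho ->
  (forall y, cube q rho y -> harmonic_at u y /\ `|u y| <= M) ->
  cube q (rho / 2) x0 ->
  (forall t, 0 <= t < 1 / 2 -> u (x0 + (t * l) *: delta_mx ord0 i) = 0) ->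
  u (x0 + l *: delta_mx ord0 i) = 0.
Proof.
move=> rho0 lrho H Hx0 U0.
have d1 : 1 <= d%:R :> R by rewrite ler1n (leq_ltn_trans _ (ltn_ord i)).
have M0 : 0 <= M.
  have [|_] := H x0; last exact: le_trans.
  by apply: cube_le Hx0; lra.
apply: (@le_half_powers_eq0 M) => m m0.
have n0 : 0 < (2 * m)%:R :> R by rewrite ltr0n muln_gt0.
(* At most [2 * m] differences, each costing [eta], use up at most half of [rho], so all of them are
   controlled at [x0]; the ratio [kappa] does not depend on [m]. *)
pose h := l / (2 * m)%:R; pose eta := rho / (2 * (2 * m)%:R).
have lh : l *: delta_mx ord0 i = (2 * m)%:R *: (h *: delta_mx ord0 i) :> 'rV[R]_d.
  by rewrite scalerA /h mulrC divfK// gt_eqF.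
have nh : `|h| = `|l| / (2 * m)%:R by rewrite /h normrM normfV (gtr0_norm n0).
have eta0 : 0 < eta by rewrite divr_gt0// mulr_gt0.
have dl : `|l| <= d%:R * `|l| by rewrite ler_peMl.
have heta : `|h| <= eta.
  have -> : eta = rho / 2 / (2 * m)%:R by rewrite /eta invfM mulrA.
  by rewrite nh ler_pM2r ?invr_gt0//; lra.
have kap : 2 * d%:R * `|h| / eta = 4 * d%:R * `|l| / rho.
  by rewrite nh /eta; field; rewrite !gt_eqF// ltr0n.
set kappa := 4 * d%:R * `|l| / rho in kap.
have kap0 : 0 <= kappa by rewrite /kappa divr_ge0 ?(ltW rho0)// !mulr_ge0.
(* The value [1 / 8] beats the factor [2 ^+ (2 * m)] from [line_differences]: the quotient of
   [4 ^+ m] by [8 ^+ m] is [2 ^- m]. *)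
have kap1 : kappa <= 1 / 8 by rewrite /kappa ler_pdivrMr//; lra.
have : `|u (x0 + (2 * m)%:R *: (h *: delta_mx ord0 i))| <= 2 ^+ (2 * m) * (M * (1 / 8) ^+ m).
  apply: line_differences => j j2m.
  have [jm|mj] := ltnP j m.
    rewrite iter_forward_difference_eq0 ?normr0; last first.
      move=> k kj; rewrite scalerA.
      have -> : k%:R * h = (k%:R / (2 * m)%:R) * l by rewrite /h; ring.
      apply: U0; rewrite divr_ge0//=.
      have : k%:R < m%:R :> R by rewrite ltr_nat (leq_ltn_trans kj).
      by rewrite ltr_pdivrMr// natrM; lra.
    by rewrite mulr_ge0// exprn_ge0//; lra.
  have Hx0j : cube q (rho - j%:R * eta) x0.
    apply: cube_le Hx0; rewrite /eta.
    have : j%:R <= (2 * m)%:R :> R by rewrite ler_nat.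
    move=> jn; have -> : j%:R * (rho / (2 * (2 * m)%:R)) = (rho / 2) * (j%:R / (2 * m)%:R).
      by field; rewrite gt_eqF// ltr0n.
    have : j%:R / (2 * m)%:R <= 1 :> R by rewrite ler_pdivrMr// mul1r.
    move=> /(ler_wpM2l (_ : 0 <= rho / 2)) => /(_ (ltW (divr_gt0 rho0 _))); lra.
  have [_] := iter_forward_difference_estimate i eta0 heta H Hx0j.
  move=> /le_trans; apply; rewrite kap ler_wpM2l//.
  apply: (@le_trans _ _ ((1/8) ^+ j)).
    by rewrite lerXn2r// ?nnegrE//; lra.
  by apply: ler_wiXn2l => //; lra.
rewrite -lh; move=> /le_trans; apply.
rewrite exprM mulrCA ler_wpM2l// -exprMn -exprVn.
by rewrite (_ : _ * (1/8) = 2^-1)//; lra.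
Qed.

(** The coordinates are widened one after the other. On the segment that resets one coordinate to
    that of [q], the first half stays within [delta' / 2 <= delta], where [u] already vanishes. *)
Lemma cube_doubling u q (rho M delta delta' : R) :
  0 < delta' -> 32 * d%:R * delta' <= rho -> delta' <= 2 * delta ->
  (forall y, cube q rho y -> harmonic_at u y /\ `|u y| <= M) ->
  (forall y, cube q delta y -> u y = 0) ->
  forall y, cube q delta' y -> u y = 0.
Proof.
move=> d'0 d'rho dd' H U0.
(* The first [k] coordinates range up to [delta'], the others only up to the smaller radius. *)
have main k : (k <= d)%N -> forall y, (forall j : 'I_d,
    `|y ord0 j - q ord0 j| < if (j < k)%N then delta' else Num.min delta delta') -> u y = 0.
  elim: k => [_ y Hy|k IH kd y Hy].
    by apply: U0 => j; have := Hy j; rewrite lt_min => /andP[].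
  pose i := Ordinal kd.
  have d1 : 1 <= d%:R :> R by rewrite ler1n (leq_ltn_trans _ kd).
  have dd1 : delta' <= d%:R * delta' by rewrite ler_peMl// ltW.
  pose l := y ord0 i - q ord0 i.
  have yi : `|l| < delta' by have := Hy i; rewrite /= ltnS leqnn.
  pose x0 := y - l *: delta_mx ord0 i.
  have -> : y = x0 + l *: delta_mx ord0 i by rewrite subrK.
  have x0j (j : 'I_d) (t : R) : (x0 + t *: delta_mx ord0 i) ord0 j - q ord0 j =
      if j == i then t else y ord0 j - q ord0 j.
    by rewrite !mxE /=; case: eqP => [->|_]; rewrite /= ?(mulr1, mulr0) /l; ring.
  have yd j : `|y ord0 j - q ord0 j| < delta'.
    by apply: lt_le_trans (Hy j) _; case: ifP => // _; rewrite ge_min lexx orbT.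
  apply: (@segment_continuation i u q x0 rho M) => //.
  - by lra.
  - apply: le_trans d'rho; rewrite ler_wpM2l// ?ltW//; lra.
  - move=> j; have := x0j j 0; rewrite scale0r addr0 => ->.
    by case: ifP => _; rewrite ?normr0; have := yd j; lra.
  move=> t /andP[t0 t1]; apply: (IH (ltnW kd)) => j; rewrite x0j.
  have := Hy j; have [->|ji] := eqVneq j i.
    rewrite ltnn ltnS leqnn normrM (ger0_norm t0) lt_min => _.
    have : t * `|l| <= 1 / 2 * `|l| by rewrite ler_wpM2r// ltW.
    by move=> h; apply/andP; split; lra.
  rewrite ltnS [(j <= k)%N]leq_eqVlt.
  suff -> : (nat_of_ord j == k) = false by [].
  by apply: contra_neqF ji => /eqP ?; apply: val_inj.
by move=> y Hy; apply: (main d (leqnn d)) => j; rewrite ltn_ord; exact: Hy.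
Qed.

(** The zero cube is doubled until it reaches radius [rho / (32 d)], the largest that
    [cube_doubling] allows; this radius does not depend on [delta]. *)
Lemma cube_continuation u q (rho M : R) : (0 < d)%N -> 0 < rho ->
  (forall y, cube q rho y -> harmonic_at u y /\ `|u y| <= M) ->
  (\forall y \near q, u y = 0) ->
  forall y, cube q (rho / (32 * d%:R)) y -> u y = 0.
Proof.
move=> d0 rho0 H /nbhs_cube[delta delta0 U0].
have dR : 0 < 32 * d%:R :> R by rewrite mulr_gt0// ltr0n.
set sigma := rho / (32 * d%:R).
have s0 : 0 < sigma by rewrite divr_gt0.
have main k : forall y, cube q (Num.min (2 ^+ k * delta) sigma) y -> u y = 0.
  elim: k => [y|k IH].
    rewrite mul1r => Hy; apply: U0; apply: cube_le Hy.
    by rewrite ge_min lexx.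
  apply: (cube_doubling _ _ _ H IH).
  - by rewrite lt_min s0 mulr_gt0// exprn_gt0.
  - apply: (@le_trans _ _ (32 * d%:R * sigma)).
      by rewrite ler_wpM2l ?(ltW dR)// ge_min lexx orbT.
    by rewrite /sigma mulrC divfK// gt_eqF.
  rewrite exprS -mulrA.
  set a := 2 ^+ k * delta.
  have [_|_] := lerP a sigma; first by rewrite ge_min lexx.
  by rewrite ge_min; apply/orP; right; lra.
have := archi_boundP (ltW (divr_gt0 s0 delta0)); set k := Num.bound _ => Hk.
move=> y Hy; apply: (main k); apply: cube_le Hy.
rewrite le_min lexx andbT -ler_pdivrMr//; apply: le_trans (ltW Hk) _.
by rewrite -natrX ler_nat ltnW// ltn_expl.
Qed.

(** Since the radius of continuation depends only on [rho] and [d], a zero neighborhood centered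
    close enough to [p], however small, spreads over [p]. *)
Lemma closure_continuation u p : (0 < d)%N ->
  (\forall y \near p, harmonic_at u y) ->
  closure [set q | \forall y \near q, u y = 0] p ->
  \forall y \near p, u y = 0.
Proof.
move=> d0 hu clp.
have : \forall y \near p, harmonic_at u y /\ `|u y| <= `|u p| + 1.
  apply: filterI => //.
  have [cu _] := nbhs_singleton hu.
  have : \forall y \near p, `|u p - u y| < 1 by exact: (cvgr_dist_lt _ _ cu).
  by apply: filterS => y h; have := ler_distD (u p) (u y) 0; rewrite !subr0 distrC; lra.
move=> /nbhs_cube[rho rho0 H].
have dR : 0 < 32 * d%:R :> R by rewrite mulr_gt0// ltr0n.
(* Half of [rho] is kept so that the cube of radius [rho / 2] about the nearby point [q] stays
   inside the cube of radius [rho] about [p]. *)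
pose sigma := rho / 2 / (32 * d%:R).
have s0 : 0 < sigma by rewrite !divr_gt0.
have sr : sigma <= rho / 2.
  rewrite /sigma ler_pdivrMr// ler_peMr//; first by lra.
  have : 1 <= d%:R :> R by rewrite ler1n.
  by lra.
have [|q [zq qp]] := clp (cube p sigma).
  by apply/nbhs_cube; exists sigma.
have qr : forall y, cube q (rho / 2) y -> harmonic_at u y /\ `|u y| <= `|u p| + 1.
  move=> y Hy; apply: H => j; have := Hy j; have := qp j.
  have := ler_distD (q ord0 j) (y ord0 j) (p ord0 j); lra.
have pq : cube q sigma p by move=> j; rewrite distrC; exact: qp.
have := open_cube pq; apply: filterS.
by apply: cube_continuation d0 _ qr zq; lra.
Qed.

(** The points near which [u] vanishes form an open set, relatively closed in [C] by
    [closure_continuation]. Segments will serve as [C]. *)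
Lemma connected_continuation u (C : set 'rV[R]_d) q : (0 < d)%N -> connected C ->
  (forall p, C p -> \forall y \near p, harmonic_at u y) ->
  C q -> (\forall y \near q, u y = 0) ->
  forall p, C p -> \forall y \near p, u y = 0.
Proof.
move=> d0 cC H Cq zq.
pose Z := [set p : 'rV[R]_d | \forall y \near p, u y = 0].
have E : C `&` Z = C.
  apply: cC; first by exists q.
    exists Z => //; rewrite openE => p Zp.
    exact: nbhs_interior.
  exists (closure Z); first exact: closed_closure.
  apply/seteqP; split => p [Cp Zp]; split => //; first exact: subset_closure.
  by apply: closure_continuation => //; exact: H.
by move=> p; rewrite -E => -[].
Qed.

End continuation.

(** * The Euclidean norm and the Newtonian kernel *)

Section euclidean.
Context (R : realType) (d : nat).
Implicit Types (u : 'rV[R]_d -> R) (x y v c : 'rV[R]_d).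

Lemma is_derive_line (f : 'rV[R]_d -> R) x v (t df : R) :
  is_derive (x + t *: v) v f df -> is_derive t 1 (fun t => f (x + t *: v)) df.
Proof.
move=> [ex val].
have E : (fun h : R => h^-1 *: (((fun t => f (x + t *: v)) \o shift t) (h *: 1) - f (x + t *: v)))
  = (fun h : R => h^-1 *: ((f \o shift (x + t *: v)) (h *: v) - f (x + t *: v))).
  apply/funext => h /=; congr (_ *: (f _ - _)).
  by rewrite [h%:A]mulr1 scalerDl addrCA.
by split; rewrite /derivable /derive E.
Qed.

(** Each partial derivative, restricted to its own coordinate line, serves as the first derivative
    [psi]. *)
Lemma harmonic_on_at (A : set 'rV[R]_d) (u : 'rV[R]_d -> R) : open A ->
  harmonic_on A u -> forall x, A x -> harmonic_at u x.
Proof.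
move=> oA [[C1 C2] lap0] x Ax; split; first by have [] := C1 _ Ax.
exists (fun i => partial i (partial i u) x) => [i|]; last exact: lap0.
exists (fun t => partial i u (x + t *: delta_mx ord0 i)).
  have : \forall t \near (0 : R), A (x + t *: delta_mx ord0 i).
    by apply: (cvg_line i); exact: open_nbhs_nbhs.
  apply: filterS => t At; apply: is_derive_line; apply: DeriveDef => //.
  by have [_ /(_ i)[]] := C1 _ At.
apply: is_derive_line; rewrite scale0r addr0; apply: DeriveDef => //.
by have [_ /(_ i)[]] := C2 i _ Ax.
Qed.

Lemma sqr_enorm x : enorm x ^+ 2 = \sum_(j < d) x ord0 j ^+ 2.
Proof. by rewrite sqr_sqrtr// sumr_ge0// => j _; exact: sqr_ge0. Qed.

Lemma enorm_ge0 x : 0 <= enorm x. Proof. exact: sqrtr_ge0. Qed.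

Lemma ler_enorm (j : 'I_d) x : `|x ord0 j| <= enorm x.
Proof.
rewrite -sqrtr_sqr ler_wsqrtr// (bigD1 j)//= lerDl.
by apply: sumr_ge0 => k _; exact: sqr_ge0.
Qed.

Lemma enormZ (s : R) x : enorm (s *: x) = `|s| * enorm x.
Proof.
rewrite /enorm (eq_bigr (fun j => s ^+ 2 * x ord0 j ^+ 2)); last first.
  by move=> j _; rewrite !mxE exprMn.
by rewrite -big_distrr/= sqrtrM ?sqr_ge0// sqrtr_sqr.
Qed.

Lemma enorm_eq0 x : (enorm x == 0) = (x == 0).
Proof.
apply/eqP/eqP => [x0|->]; last first.
  by rewrite -(scale0r 0) enormZ normr0 mul0r.
apply/rowP => j; apply/eqP; rewrite mxE -normr_le0 -x0; exact: ler_enorm.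
Qed.

Lemma enorm_gt0 x : (0 < enorm x) = (x != 0).
Proof. by rewrite lt_neqAle enorm_ge0 andbT eq_sym enorm_eq0. Qed.

(** Stands in for the triangle inequality when showing that points far from a center are far from
    the origin. *)
Lemma sqr_enormB_le x y : enorm (x - y) ^+ 2 <= 2 * enorm x ^+ 2 + 2 * enorm y ^+ 2.
Proof.
rewrite !sqr_enorm !big_distrr -big_split/=; apply: ler_sum => j _.
by rewrite !mxE; have := sqr_ge0 (x ord0 j + y ord0 j); lra.
Qed.

Lemma enorm_delta (i : 'I_d) : enorm (delta_mx ord0 i : 'rV[R]_d) = 1.
Proof.
rewrite /enorm (bigD1 i)//= big1 ?addr0; last first.
  by move=> j /negPf ji; rewrite mxE ji andbF expr0n.
by rewrite mxE !eqxx expr1n sqrtr1.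
Qed.

Lemma continuous_enormB c : continuous (fun x => enorm (x - c)).
Proof.
have E x : enorm (x - c) = Num.sqrt (\sum_(j < d) (x ord0 j - c ord0 j) ^+ 2).
  by congr Num.sqrt; apply: eq_bigr => j _; rewrite !mxE.
rewrite (funext E) => x.
apply: (@continuous_comp _ _ _
  (fun x : 'rV[R]_d => \sum_(j < d) (x ord0 j - c ord0 j) ^+ 2) Num.sqrt).
  apply: (@continuous_coord_sum _ _ (fun j s => (s - c ord0 j) ^+ 2)) => j s.
  apply: (@continuous_comp _ _ _ (fun s => s - c ord0 j) (fun s => s ^+ 2)).
    by apply: continuousB; [exact: cvg_id|exact: cst_continuous].
  exact: exprn_continuous.
exact: sqrt_continuous.
Qed.

(** A negative [a] gives the closed ball, so balls and annuli are treated together. *)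
Lemma compact_shell c (a b : R) : compact [set x | a <= enorm (x - c) <= b].
Proof.
apply: (@subclosed_compact _ _ [set z : 'rV[R]_d |
    forall j, c ord0 j - b <= z ord0 j <= c ord0 j + b]); last 2 first.
- exact: compact_box.
- move=> x /= /andP[_ xb] j; have := ler_enorm j (x - c).
  by rewrite !mxE => /le_trans /(_ xb); rewrite ler_norml; lra.
have := @closed_comp _ _ (fun x => enorm (x - c)) `[a, b]%classic.
rewrite (_ : _ @^-1` _ = [set x | a <= enorm (x - c) <= b]).
  by apply; [move=> x _; exact: continuous_enormB|exact: interval_closed].
by apply/seteqP; split => x /=; rewrite in_itv.
Qed.

Lemma interior_shell c (a b : R) x : a < enorm (x - c) < b ->
  [set x | a <= enorm (x - c) <= b]° x.
Proof.
move=> H.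
have /near_in_itvoo ab : enorm (x - c) \in `]a, b[ by rewrite in_itv.
have : nbhs (enorm (x - c)) [set t | a <= t <= b].
  by apply: filterS ab => z; rewrite in_itv/= => /andP[/ltW -> /ltW ->].
exact: continuous_enormB.
Qed.

Lemma connected_segment x v (a b : R) : connected [set x + s *: v | s in `[a, b]%classic].
Proof.
apply: connected_continuous_connected; first exact: segment_connected.
apply: continuous_subspaceT => s.
have h := @scalel_continuous _ _ v s.
exact: (cvgD (cvg_cst x) h).
Qed.

(** Off the boundary, [A] and its closure have the same trace on [C], so this trace is both open and
    closed in [C]. *)
Lemma connected_sub_open (A C : set 'rV[R]_d) : open A -> connected C ->
  (forall x, C x -> ~ boundary A x) -> C `&` A !=set0 -> C `<=` A.
Proof.
move=> oA cC CA CA0.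
suff <- : C `&` A = C by move=> x [].
apply: cC => //; first by exists A.
exists (closure A); first exact: closed_closure.
apply/seteqP; split => x [Cx Ax]; split => //; first exact: subset_closure.
apply: contrapT => nAx; apply: (CA x Cx); split => // /interior_subset; exact: nAx.
Qed.

End euclidean.

Section newtonian.
Context (R : realType) (d : nat).
Implicit Types (x y c : 'rV[R]_d).

Lemma is_deriveV1 (f : R -> R) (t df : R) : f t != 0 -> is_derive t 1 f df ->
  is_derive t 1 (fun s => (f s)^-1) (- (f t) ^- 2 * df).
Proof.
move=> f0 [ex <-]; apply: DeriveDef; first exact: derivableV.
exact: deriveV.
Qed.

(** On a coordinate line the Euclidean distance is the square root of such a quadratic. The
    derivative contains a power of the same form, so the rule can be used a second time with
    [k.+2]. *)
Lemma is_derive_sqrt_quadratic (a b t : R) (k : nat) :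
  0 < a + 2 * b * t + t ^+ 2 ->
  is_derive t 1 (fun t => (Num.sqrt (a + 2 * b * t + t ^+ 2) ^+ k.+1)^-1)
    (- k.+1%:R * ((b + t) * (Num.sqrt (a + 2 * b * t + t ^+ 2) ^+ k.+3)^-1)).
Proof.
set Q := fun t : R => a + 2 * b * t + t ^+ 2 => Q0.
have dQ : is_derive t 1 Q (2 * b + 2 * t).
  apply: is_derive_eq; rewrite /GRing.scale/=; ring.
have dS : is_derive t 1 (fun t => Num.sqrt (Q t)) ((2 * Num.sqrt (Q t))^-1 * (2 * b + 2 * t)).
  have h := @is_derive1_comp _ (@Num.sqrt R) Q t (2 * Num.sqrt (Q t))^-1 _
    (is_derive1_sqrt Q0) dQ.
  exact: h.
have S0 : 0 < Num.sqrt (Q t) by rewrite sqrtr_gt0.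
have dX : is_derive t 1 (fun t => Num.sqrt (Q t) ^+ k.+1)
    (k.+1%:R * Num.sqrt (Q t) ^+ k * ((2 * Num.sqrt (Q t))^-1 * (2 * b + 2 * t))).
  by have := @is_deriveX _ _ _ k.+1 _ _ _ dS; rewrite exprfctE.
apply: is_derive_eq.
  by apply: is_deriveV1 dX; rewrite expf_neq0// gt_eqF.
rewrite -/(Q t).
set S := Num.sqrt (Q t) in S0 *.
by rewrite !exprS; field; rewrite expf_neq0 ?gt_eqF.
Qed.

(** With [z = x - c], the [i]-th second derivative is [-(d - 2) (N^-d - d z_i^2 N^-(d+2))]; the sum
    vanishes because the [z_i^2] add up to [N^2]. *)
Lemma harmonic_at_newtonian c x : x != c -> (2 < d)%N ->
  harmonic_at (fun x => (enorm (x - c) ^+ (d - 2))^-1) x.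
Proof.
move=> xc d2; pose N := enorm (x - c).
have N0 : 0 < N by rewrite enorm_gt0 subr_eq0.
split.
  apply: (@continuousV _ _ (fun x => enorm (x - c) ^+ (d - 2))).
    by rewrite expf_neq0// gt_eqF.
  apply: (@continuous_comp _ _ _ (fun x => enorm (x - c)) (fun s => s ^+ (d - 2))).
    exact: continuous_enormB.
  exact: exprn_continuous.
case: d d2 x c xc @N N0 => [//|[//|[//|k]]] _ x c xc N N0.
have -> : (k.+3 - 2 = k.+1)%N by rewrite !subSS subn0.
pose z := x - c.
exists (fun i => - k.+1%:R * (1 * (N ^+ k.+3)^-1 +
    z ord0 i * (- k.+3%:R * (z ord0 i * (N ^+ k.+4.+1)^-1)))) => [i|].
  have E t : enorm (x + t *: delta_mx ord0 i - c) =
      Num.sqrt (N ^+ 2 + 2 * z ord0 i * t + t ^+ 2).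
    congr Num.sqrt; rewrite sqr_enorm (bigD1 i)//= [X in _ = X + _ + _](bigD1 i)//=.
    rewrite (eq_bigr (fun j => (x - c) ord0 j ^+ 2)); last first.
      by move=> j /negPf ji; rewrite !mxE ji andbF mulr0 addr0.
    by rewrite /z !mxE !eqxx /=; ring.
  exists (fun t => - k.+1%:R * ((z ord0 i + t) *
      (Num.sqrt (N ^+ 2 + 2 * z ord0 i * t + t ^+ 2) ^+ k.+3)^-1)).
    have : \forall t \near (0 : R), 0 < N ^+ 2 + 2 * z ord0 i * t + t ^+ 2.
      have cq : {for (0 : R), continuous (fun t : R => N ^+ 2 + 2 * z ord0 i * t + t ^+ 2)}.
        apply/differentiable_continuous/derivable1_diffP.
        exact: ex_derive.
      by apply: (cvgr_gt _ cq); rewrite mulr0 expr0n /= !addr0 exprn_gt0.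
    apply: filterS => t Qt.
    have := is_derive_sqrt_quadratic k Qt.
    congr (is_derive t 1 _ _).
    by apply/funext => s; rewrite E.
  have Q0 : 0 < N ^+ 2 + 2 * z ord0 i * 0 + 0 ^+ 2.
    by rewrite mulr0 expr0n /= !addr0 exprn_gt0.
  have dG := is_derive_sqrt_quadratic k.+2 Q0.
  have dL : is_derive (0 : R) 1 (fun t : R => z ord0 i + t) 1.
    have := @is_deriveD _ _ _ (cst (z ord0 i)) id (0 : R) 1 0 1.
    by rewrite add0r; apply.
  apply: is_derive_eq.
  have -> : Num.sqrt (N ^+ 2 + 2 * z ord0 i * 0 + 0 ^+ 2) = N.
    by rewrite mulr0 expr0n /= !addr0 sqrtr_sqr gtr0_norm.
  rewrite /GRing.scale/= !addr0; ring.
rewrite -big_distrr/= big_split/= sumr_const card_ord.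
rewrite (eq_bigr (fun i => (- k.+3%:R * (N ^+ k.+4.+1)^-1) * z ord0 i ^+ 2)); last first.
  by move=> i _; ring.
rewrite -big_distrr/= -sqr_enorm -/N.
have -> : N ^+ k.+4.+1 = N ^+ 2 * N ^+ k.+3 by rewrite -exprD.
rewrite -mulr_natl; field.
by rewrite !gt_eqF// exprn_gt0.
Qed.

End newtonian.

(** * Continuation around a puncture *)

Section puncture.
Context (R : realType) (d : nat).
Implicit Types (u : 'rV[R]_d -> R) (p q x y z c : 'rV[R]_d).

Lemma nbhs_neq x c : x != c -> \forall y \near x, y != c.
Proof.
move=> xc; apply: (@open_nbhs_nbhs _ x [set y | y != c]); split => //.
rewrite (_ : [set y | y != c] = ~` [set c]).
  rewrite openC; apply: accessible_closed_set1; apply: hausdorff_accessible.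
  exact: norm_hausdorff.
by apply/seteqP; split => y /= /eqP.
Qed.

Lemma convex_lt (a b e s : R) : a < e -> b < e -> 0 <= s <= 1 -> a + s * (b - a) < e.
Proof.
move=> ae be /andP[s0 s1].
have [m [am bm me]] : exists m, [/\ a <= m, b <= m & m < e].
  by exists (Num.max a b); rewrite !le_max !lexx orbT gt_max ae.
by apply: le_lt_trans me; nra.
Qed.

Lemma cube_segment c q y (e s : R) : cube c e q -> cube c e y -> 0 <= s <= 1 ->
  cube c e (q + s *: (y - q)).
Proof.
move=> Hq Hy s01 j; have := Hq j; have := Hy j.
rewrite !mxE !ltr_norml => /andP[y1 y2] /andP[q1 q2].
have := convex_lt q2 y2 s01.
have /convex_lt : - (q ord0 j - c ord0 j) < e by lra.
have yc : - (y ord0 j - c ord0 j) < e by lra.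
by move=> /(_ _ _ yc s01); lra.
Qed.

(** The segment from [q] to [y] keeps the coordinate [i] different from that of [c], so it misses
    the puncture. *)
Lemma fixed_coord_continuation u c q y (e : R) (i : 'I_d) : (0 < d)%N ->
  (forall x, cube c e x -> x != c -> harmonic_at u x) ->
  cube c e q -> cube c e y -> q ord0 i != c ord0 i -> y ord0 i = q ord0 i ->
  (\forall x \near q, u x = 0) -> \forall x \near y, u x = 0.
Proof.
move=> d0 H Hq Hy qi yi zq.
have ne x : x ord0 i = q ord0 i -> x != c.
  by move=> E; apply: contraNneq qi => <-; rewrite E.
apply: (@connected_continuation _ _ u _ q d0 (@connected_segment _ _ q (y - q) 0 1)) => //.
- move=> _ [s /= s01 <-]; rewrite in_itv/= in s01.
  have xc : q + s *: (y - q) != c by apply: ne; rewrite !mxE yi subrr mulr0 addr0.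
  have : \forall x \near q + s *: (y - q), cube c e x.
    exact: open_nbhs_nbhs (conj (@open_cube _ _ _ _) (cube_segment Hq Hy s01)).
  have := nbhs_neq xc.
  by move=> H1 H2; apply: filterS2 H1 H2 => x x1 x2; exact: H.
- by exists 0; rewrite ?scale0r ?addr0//= in_itv/= lexx ler01.
- by exists 1; rewrite ?scale1r ?subrKC//= in_itv/= lexx ler01.
Qed.

Lemma neq_coord x c : x != c -> exists j, x ord0 j != c ord0 j.
Proof.
move=> xc; apply: contrapT => /forallNP H; move/eqP: xc; apply.
by apply/rowP => j; apply/eqP/negPn/negP/H.
Qed.

(* Three coordinate-preserving segments join any two points of the cube while
   avoiding its center; the third coordinate [k] needs [2 < d]. *)
Lemma puncture_continuation u c q y (e : R) : (2 < d)%N -> 0 < e ->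
  (forall x, cube c e x -> x != c -> harmonic_at u x) ->
  cube c e q -> cube c e y -> q != c -> y != c ->
  (\forall x \near q, u x = 0) -> \forall x \near y, u x = 0.
Proof.
move=> d2 e0 H Hq Hy /neq_coord[i qi] /neq_coord[j yj] zq.
have d0 : (0 < d)%N by apply: leq_trans d2.
have [k ki kj] : exists2 k : 'I_d, k != i & k != j.
  have : (0 < #|predC (pred2 i j)|)%N.
    rewrite -(ltn_add2l #|pred2 i j|) addn0 cardC card_ord card2.
    by apply: leq_ltn_trans d2; case: (i != j).
  by move=> /card_gt0P[k]; rewrite !inE negb_or => /andP[]; exists k.
have ck : c ord0 k + e / 2 != c ord0 k by rewrite -subr_eq0 addrAC subrr add0r gt_eqF// divr_gt0.
(* The waypoints share the coordinate [k], moved off the center by half the radius; the three legs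
   keep the coordinates [i], [k] and [j] fixed in turn. *)
pose q1 : 'rV[R]_d := \row_l
  (if l == i then q ord0 l else if l == k then c ord0 k + e / 2 else c ord0 l).
pose q2 : 'rV[R]_d := \row_l
  (if l == k then c ord0 k + e / 2 else if l == j then y ord0 l else c ord0 l).
have he : `|c ord0 k + e / 2 - c ord0 k| < e.
  by rewrite addrAC subrr add0r gtr0_norm; lra.
have Hq1 : cube c e q1.
  move=> l; rewrite mxE; case: eqP => _; first exact: Hq.
  by case: eqP => [->//|_]; rewrite subrr normr0.
have Hq2 : cube c e q2.
  move=> l; rewrite mxE; case: eqP => [->//|_].
  by case: eqP => [_|_]; [exact: Hy|rewrite subrr normr0].
have q1i : q1 ord0 i = q ord0 i by rewrite mxE eqxx.
have q1k : q1 ord0 k = c ord0 k + e / 2 by rewrite mxE (negPf ki) eqxx.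
have q2k : q2 ord0 k = c ord0 k + e / 2 by rewrite mxE eqxx.
have q2j : q2 ord0 j = y ord0 j by rewrite mxE eq_sym (negPf kj) eqxx.
have z1 : \forall x \near q1, u x = 0.
  exact: (fixed_coord_continuation d0 H Hq Hq1 qi q1i zq).
have z2 : \forall x \near q2, u x = 0.
  by apply: (fixed_coord_continuation (i := k) d0 H Hq1 Hq2 _ _ z1); rewrite q1k.
by apply: (fixed_coord_continuation (i := j) d0 H Hq2 Hy _ _ z2); rewrite q2j.
Qed.

(** Using neighborhoods that ignore the value at [c] gives a set [Z] that may contain [c], so the
    connectedness of [A] itself suffices. Closedness at [c] comes from [puncture_continuation]. *)
Lemma punctured_domain_continuation u (A : set 'rV[R]_d) c q : (2 < d)%N ->
  open A -> connected A ->
  (forall x, A x -> x != c -> harmonic_at u x) ->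
  A q -> (\forall x \near q, u x = 0) ->
  forall x, A x -> x != c -> u x = 0.
Proof.
move=> d2 oA cA H Aq zq.
have d0 : (0 < d)%N by apply: leq_trans d2.
have near_A x : A x -> \forall y \near x, A y by move=> Ax; exact: open_nbhs_nbhs.
pose Z := [set p : 'rV[R]_d | \forall y \near p, y != c -> u y = 0].
have Z_ne p : Z p -> p != c -> \forall y \near p, u y = 0.
  by move=> Zp pc; apply: filterS2 Zp (nbhs_neq pc) => y; apply.
have E : A `&` Z = A.
  apply: cA; first by exists q; split => //; apply: filterS zq.
    by exists Z => //; rewrite openE => p Zp; exact: nbhs_interior.
  exists (closure Z); first exact: closed_closure.
  apply/seteqP; split => p [Ap Zp]; split => //; first exact: subset_closure.
  have [pc|pc] := eqVneq p c; last first.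
    suff : \forall y \near p, u y = 0 by apply: filterS.
    apply: closure_continuation => //.
      by apply: filterS2 (near_A _ Ap) (nbhs_neq pc) => y; exact: H.
    move=> B Bp; have [|r [Zr [Br rc]]] := Zp (B `&` [set r | r != c]).
      by apply: filterI => //; exact: nbhs_neq.
    by exists r; split => //; exact: Z_ne.
  have [e e0 He] := (nbhs_cube _ _).1 (near_A _ Ap).
  have [|r [Zr re]] := Zp (cube p e); first by apply/nbhs_cube; exists e.
  have [rc|rc] := eqVneq r c; first by rewrite pc -rc.
  apply/nbhs_cube; exists e => // y Hy yc.
  suff : \forall z \near y, u z = 0 by exact: nbhs_singleton.
  apply: (@puncture_continuation u c r y e) => //; try by rewrite -pc.
    by move=> x Hx; apply: H; apply: He; rewrite pc.
  exact: Z_ne.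
move=> x; rewrite -{1}E => -[_ Zx] xc.
exact: nbhs_singleton (Z_ne _ Zx xc).
Qed.

End puncture.

(** * The exterior of a sphere *)

Lemma normr_div_exprn_le (R : realType) (n : nat) (k N e : R) :
  (0 < n)%N -> 0 < e -> 1 <= N -> `|k| / e <= N -> `|k / N ^+ n| <= e.
Proof.
move=> n0 e0 N1 kN.
have N0 : 0 < N by apply: lt_le_trans N1.
rewrite normrM normfV (ger0_norm (exprn_ge0 _ (ltW N0))) ler_pdivrMr ?exprn_gt0//.
rewrite mulrC -ler_pdivrMr//; apply: le_trans kN _.
by rewrite ler_eXnr.
Qed.

Section exterior.
Context (R : realType) (d : nat).
Implicit Types (u v : 'rV[R]_d -> R) (x y c : 'rV[R]_d).

(** The maximum principle for [v - e] on a shell whose outer radius reaches both [x] and the region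
    where [v <= e]; then [e] is arbitrary. *)
Lemma exterior_le0 v c (rho : R) : (0 < d)%N ->
  (forall x, rho <= enorm (x - c) -> harmonic_at v x) ->
  (forall x, enorm (x - c) = rho -> v x <= 0) ->
  (forall e : R, 0 < e -> exists B : R, forall y, B <= enorm (y - c) -> v y <= e) ->
  forall x, rho <= enorm (x - c) -> v x <= 0.
Proof.
move=> d0 H Hrho Hinf x Hx; apply/ler_addgt0Pr => e e0; rewrite add0r -subr_le0.
have [B HB] := Hinf _ e0.
pose B' := Num.max B (enorm (x - c)).
have He y : rho <= enorm (y - c) -> harmonic_at (fun y => v y + (- e)) y.
  by move=> Hy; apply: harmonic_atD (H _ Hy) _; exact: harmonic_at_cst.
apply: (@max_principle _ _ [set y | rho <= enorm (y - c) <= B'] (fun y => v y + (- e))) => //.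
- exact: compact_shell.
- by apply: within_continuous_at => y /= /andP[y1 _]; exact: (He _ y1).1.
- move=> y /= /andP[y1 y2].
  move: y1; rewrite le_eqVlt => /orP[/eqP y1|y1].
    by left; have := Hrho y (esym y1); lra.
  move: y2; rewrite le_eqVlt => /orP[/eqP y2|y2].
    by left; rewrite subr_le0; apply: HB; rewrite y2 le_max lexx.
  by right; split; [apply: interior_shell; rewrite y1|exact: (He _ (ltW y1)).2].
- by rewrite /= Hx le_max lexx orbT.
Qed.

(** The difference with the kernel matching [a] on the sphere is zero there and tends to 0 at
    infinity; [exterior_le0] applies to it and to its opposite. *)
Lemma exterior_uniqueness u c (rho a : R) : (2 < d)%N -> 0 < rho ->
  (forall x, rho <= enorm (x - c) -> harmonic_at u x) ->
  (forall x, enorm (x - c) = rho -> u x = a) ->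
  (forall e : R, 0 < e -> exists B : R, forall y, B <= enorm (y - c) -> `|u y| <= e) ->
  forall x, rho <= enorm (x - c) ->
    u x = a * rho ^+ (d - 2) / enorm (x - c) ^+ (d - 2).
Proof.
move=> d2 rho0 H Hrho Hinf.
have d0 : (0 < d)%N by apply: leq_trans d2.
set k := a * _.
pose v x := u x + (-1) * (k * (enorm (x - c) ^+ (d - 2))^-1).
have Hv x : rho <= enorm (x - c) -> harmonic_at v x.
  move=> Hx; apply: harmonic_atD (H _ Hx) _; do 2 apply: harmonic_atZ.
  by apply: harmonic_at_newtonian => //; rewrite -subr_eq0 -enorm_gt0 (lt_le_trans rho0).
have vrho x : enorm (x - c) = rho -> v x = 0.
  move=> Hx; rewrite /v Hx Hrho// /k mulfK ?mulN1r ?subrr//.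
  by rewrite expf_neq0// gt_eqF.
have vinf e : 0 < e -> exists B : R, forall y, B <= enorm (y - c) -> `|v y| <= e.
  move=> e0; have e2 : 0 < e / 2 by rewrite divr_gt0.
  have [B HB] := Hinf _ e2; exists (Num.max B (Num.max 1 (`|k| / (e / 2)))) => y.
  rewrite !ge_max => /and3P[/HB yB y1 yk].
  have := normr_div_exprn_le (_ : (0 < d - 2)%N) e2 y1 yk.
  rewrite subn_gt0 => /(_ d2) ky.
  have := ler_normD (u y) (-1 * (k * (enorm (y - c) ^+ (d - 2))^-1)).
  by rewrite mulN1r normrN /v mulN1r; lra.
have v0 x : rho <= enorm (x - c) -> v x = 0.
  move=> Hx; apply/eqP; rewrite eq_le; apply/andP; split.
    apply: (@exterior_le0 v c rho d0 Hv _ _ x Hx) => [y /vrho->//|e e0].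
    by have [B HB] := vinf _ e0; exists B => y /HB; apply: le_trans; exact: ler_norm.
  rewrite -oppr_le0 -mulN1r.
  apply: (@exterior_le0 (fun y => -1 * v y) c rho d0 _ _ _ x Hx).
  - by move=> y Hy; apply: harmonic_atZ; exact: Hv.
  - by move=> y /vrho->; rewrite mulr0.
  move=> e e0; have [B HB] := vinf _ e0; exists B => y /HB; apply: le_trans.
  by rewrite mulN1r -normrN; exact: ler_norm.
by move=> x /v0 /eqP; rewrite /v mulN1r subr_eq0 => /eqP.
Qed.
End exterior.

(** * Distant points equidistant from the origin and a center *)

Section equidistant.
Context (R : realType) (d : nat).
(** The asymptotics involve [enorm x], the exterior formula [enorm (x - c)]; on the bisecting
    hyperplane through [c / 2] the two agree, and points [c / 2 + t w] with [w] orthogonal to [c] go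
    to infinity. *)
Lemma far_equidistant (c : 'rV[R]_d) (M : R) : (1 < d)%N ->
  exists2 x, enorm x = enorm (x - c) & M < enorm x.
Proof.
move=> d1; have [i [j ji]] : exists i j : 'I_d, j != i.
  by exists (Ordinal (ltnW d1)), (Ordinal d1).
(* The direction [w] lies in the plane of the axes [i] and [j]; the rotated pair [(c_j, - c_i)] is
   replaced by [(1, 0)] when [c_i = 0], where it might be zero. *)
have [a [b [orth ab0]]] : exists a b : R, a * c ord0 i + b * c ord0 j = 0 /\ (a != 0 \/ b != 0).
  have [ci|ci] := eqVneq (c ord0 i) 0.
    by exists 1, 0; rewrite ci mulr0 mul0r addr0 oner_neq0; split => //; left.
  by exists (c ord0 j), (- c ord0 i); split; [ring|right; rewrite oppr_eq0].
pose x (t : R) := 2^-1 *: c + t *: (a *: delta_mx ord0 i + b *: delta_mx ord0 j).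
have xE t : enorm (x t) = enorm (x t - c).
  congr Num.sqrt; apply/eqP; rewrite -subr_eq0 -sumrB.
  rewrite (eq_bigr (fun l => t * (2 * a * (l == i)%:R * c ord0 l) +
    t * (2 * b * (l == j)%:R * c ord0 l))); last first.
    by move=> l _; rewrite !mxE /=; field.
  have S (k : 'I_d) (g : R) :
      \sum_(l < d) t * (2 * g * (l == k)%:R * c ord0 l) = t * 2 * (g * c ord0 k).
    rewrite (bigD1 k)//= eqxx big1 ?addr0; first by rewrite mulr1; ring.
    by move=> l /negPf ->; rewrite mulr0 mul0r mulr0.
  by rewrite big_split/= !S -mulrDr orth mulr0.
have far (k : 'I_d) (g : R) : g != 0 -> (forall t, x t ord0 k = 2^-1 * c ord0 k + t * g) ->
    exists t, M < enorm (x t).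
  move=> g0 H; exists ((`|M| + 1 - 2^-1 * c ord0 k) / g).
  apply: lt_le_trans (ler_enorm k _); rewrite H divfK// subrKC.
  by have := ler_norm M; have := ler_norm (`|M| + 1); lra.
have [t Ht] : exists t, M < enorm (x t).
  case: ab0 => g0; [apply: (far i _ g0)|apply: (far j _ g0)] => t.
    by rewrite !mxE !eqxx eq_sym (negPf ji) /=; ring.
  by rewrite !mxE !eqxx (negPf ji) /=; ring.
by exists (x t).
Qed.
End equidistant.

(** * From one spherical equipotential to the potential on [Omega] *)

Theorem theorem3p4 (R : realType) (d : nat) (Phi : R)
    (Omega : set 'rV[R]_d) (U : 'rV[R]_d -> R) (r0 : 'rV[R]_d) :
  (2 < d)%N ->
  0 < Phi ->
  domain Omega ->
  ~ bounded_set Omega ->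
  compact (boundary Omega) ->
  connected (boundary Omega) ->
  hypersurface (boundary Omega) ->
  harmonic_on Omega U ->
  U ~_(within Omega (@at_infinity R d)) (point_potential Phi) ->
  (exists S : set 'rV[R]_d, equipotential_surface Omega U S /\
     exists2 rho : R, 0 < rho & S = hypersphere r0 rho) ->
  forall r, Omega r -> U r = point_potential Phi (r - r0).
Proof.
move=> d2 _ [oO cO _] _ _ cB [[b0 Bb0] _] hU asym [S [[_ SO [a Sa]] [rho rho0 Srho]]].
have d0 : (0 < d)%N by apply: leq_trans d2.
pose i0 : 'I_d := Ordinal d0.
pose n := (d - 2)%N.
have n0 : (0 < n)%N by rewrite subn_gt0.
have HU := harmonic_on_at oO hU.
pose N x := enorm (x - r0).
have Ni (t : R) : 0 <= t -> N (r0 + t *: delta_mx ord0 i0) = t.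
  by move=> t0; rewrite /N addrAC subrr add0r enormZ enorm_delta mulr1 ger0_norm.
have sphereO x : N x = rho -> Omega x /\ U x = a.
  move=> Nx; have : S x by rewrite Srho.
  by rewrite Sa.
have levelO x : Omega x -> U x = a -> N x = rho.
  move=> Ox Ux; have : S x by rewrite Sa.
  by rewrite Srho.
have BO x : boundary Omega x -> ~ Omega x.
  by move=> [_ nO] Ox; apply: nO; exact: oO.
have Bne x : boundary Omega x -> N x <> rho.
  by move=> Bx Nx; exact: (BO _ Bx (sphereO _ Nx).1).
(* All constants, including the integral, are gathered in the value at a unit vector; at [r = 0]
   both sides are the junk value 0. *)
have [K HK] : exists K : R, forall r : 'rV[R]_d, point_potential Phi r = K / enorm r ^+ n.
  exists (point_potential Phi (delta_mx ord0 i0)) => r.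
  rewrite /point_potential enorm_delta expr1n mulr1 -/n.
  by set A := d%:R * _ * _; rewrite (invfM A); ring.
have asymE e : 0 < e -> exists M : R, forall x, Omega x -> M < enorm x ->
    `|U x - K / enorm x ^+ n| <= e * `|K / enorm x ^+ n|.
  move=> e0; have [M _ HM] := (eqaddoP _ _ _ _).1 asym e e0.
  by exists M => x Ox Mx; rewrite -HK; exact: HM.
have cN : continuous N by exact: continuous_enormB.
have near_gt (b : R) x : b < N x -> \forall y \near x, b < N y.
  by move=> bx; exact: (cvgr_gt _ (cN x)).
have Nseg x (s : R) : N (r0 + s *: (x - r0)) = `|s| * N x.
  by rewrite /N addrAC subrr add0r enormZ.
have inside x : boundary Omega x -> N x < rho.
  move=> Bx.
  have [[b [Bb Nb]]|out] := pselect (exists b, boundary Omega b /\ N b < rho).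
    (* The sphere misses the boundary, so [N < rho] and [N <= rho] cut out the same subset of it,
       both open and closed. *)
    have E : boundary Omega `&` [set y | N y < rho] = boundary Omega.
      apply: cB; first by exists b.
        exists [set y | N y < rho] => //.
        rewrite openE => y /= Ny; exact: (cvgr_lt _ (cN y)).
      exists [set y | N y <= rho].
        have := @closed_comp _ _ N [set t | t <= rho].
        by apply; [move=> y _; exact: cN|exact: closed_le].
      apply/seteqP; split => y [By Ny]; split => //=; first exact: ltW.
      by rewrite lt_neqAle Ny andbT; apply/eqP; exact: Bne.
    by have [] : (boundary Omega `&` [set y | N y < rho]) x by rewrite E.
  (* In the remaining case the closed ball misses the boundary; segments then put first [r0] and
     next the whole ball inside [Omega]. *)
  have ballB y : N y <= rho -> ~ boundary Omega y.
    move=> Ny By; apply: out; exists y; split => //.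
    by rewrite lt_neqAle Ny andbT; apply/eqP; exact: Bne.
  have Or0 : Omega r0.
    apply: (connected_sub_open oO (@connected_segment _ _ r0 (delta_mx ord0 i0) 0 rho)).
    - move=> _ [s /= + <-]; rewrite in_itv/= => /andP[s0 sr].
      by apply: ballB; rewrite Ni.
    - exists (r0 + rho *: delta_mx ord0 i0); split.
        by exists rho => //=; rewrite in_itv/= lexx ltW.
      by have [] := sphereO (r0 + rho *: delta_mx ord0 i0) (Ni _ (ltW rho0)).
    - by exists 0; rewrite ?scale0r ?addr0//= in_itv/= lexx ltW.
  have ballO y : N y <= rho -> Omega y.
    move=> Ny; apply: (connected_sub_open oO (@connected_segment _ _ r0 (y - r0) 0 1)).
    - move=> _ [s /= + <-]; rewrite in_itv/= => /andP[s0 s1].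
      apply: ballB; rewrite Nseg ger0_norm//; apply: le_trans Ny.
      by rewrite ler_piMl// enorm_ge0.
    - exists r0; split => //.
      by exists 0; rewrite ?scale0r ?addr0//= in_itv/= lexx ler01.
    - by exists 1; rewrite ?scale1r ?subrKC//= in_itv/= lexx ler01.
  have Nr0 : N r0 = 0 by apply/eqP; rewrite enorm_eq0 subrr.
  (* The signs [k = 1] and [k = -1] give the two inequalities for [U r0 = a]; the inner radius [-1]
     turns the shell into a ball. *)
  have bal (k : R) : k * U r0 + (- (k * a)) <= 0.
    have Hk y : N y <= rho -> harmonic_at (fun y => k * U y + (- (k * a))) y.
      move=> Ny; apply: harmonic_atD; last exact: harmonic_at_cst.
      by apply: harmonic_atZ; apply: HU; exact: ballO.
    apply: (@max_principle _ _ [set y | -1 <= enorm (y - r0) <= rho]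
      (fun y => k * U y + (- (k * a)))) => //.
    - exact: compact_shell.
    - by apply: within_continuous_at => y /= /andP[_ y1]; exact: (Hk _ y1).1.
    - move=> y /= /andP[_]; rewrite le_eqVlt => /orP[/eqP y1|y1].
        by left; rewrite (sphereO _ y1).2 subrr.
      right; split; last exact: (Hk _ (ltW y1)).2.
      by apply: interior_shell; rewrite y1 andbT; have := enorm_ge0 (y - r0); lra.
    - by rewrite /= -/(N r0) Nr0; apply/andP; split; lra.
  have Ur0 : U r0 = a by have := bal 1; have := bal (-1); lra.
  by have := levelO _ Or0 Ur0; rewrite Nr0; lra.
(* The radial segment from the sphere, met at parameter [rho / N x], out to [x] avoids the
   boundary. *)
have exteriorO x : rho <= N x -> Omega x.
  move=> Nx; have Nx0 : 0 < N x by exact: lt_le_trans Nx.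
  have r1 : rho / N x <= 1 by rewrite ler_pdivrMr// mul1r.
  have r_ge0 : 0 <= rho / N x by rewrite divr_ge0// ltW.
  apply: (connected_sub_open oO (@connected_segment _ _ r0 (x - r0) (rho / N x) 1)).
  - move=> _ [s /= + <-]; rewrite in_itv/= => /andP[s0 s1] /inside.
    rewrite Nseg ger0_norm; last exact: le_trans s0.
    by apply/negP; rewrite -leNgt -ler_pdivrMr.
  - exists (r0 + (rho / N x) *: (x - r0)); split.
      by exists (rho / N x) => //=; rewrite in_itv/= lexx.
    by apply: (sphereO _ _).1; rewrite Nseg ger0_norm// divfK// gt_eqF.
  - by exists 1; rewrite ?scale1r ?subrKC//= in_itv/= lexx andbT.
have Uinf e : 0 < e -> exists B : R, forall y, B <= N y -> `|U y| <= e.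
  move=> e0; have e2 : 0 < e / 2 by rewrite divr_gt0.
  (* Relative error 1 already bounds [|U y|] by twice [|K| / |y|^n], hence the target [e / 2]. *)
  have [M HM] := asymE 1 ltr01.
  pose L := Num.max M (Num.max 1 (`|K| / (e / 2))).
  have L1 : 1 <= L by rewrite !le_max lexx orbT.
  exists (Num.max rho (2 * (L + enorm r0))) => y; rewrite ge_max => /andP[y1 y2].
  have yL : L < enorm y.
    rewrite ltNge; apply/negP => yL.
    have := sqr_enormB_le y r0; have := enorm_ge0 y; have := enorm_ge0 r0.
    move: y2; rewrite /N; set p := enorm (y - r0); set q := enorm y; set r := enorm r0.
    move=> y2 r_ge0 q_ge0 pqr.
    have : q ^+ 2 <= L ^+ 2 by rewrite lerXn2r// nnegrE; lra.
    have : (2 * (L + r)) ^+ 2 <= p ^+ 2 by rewrite lerXn2r// nnegrE; lra.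
    by nra.
  move: (yL); rewrite /L !gt_max => /and3P[yM /ltW y_ge1 /ltW yK].
  have := HM _ (exteriorO _ y1) yM; have := normr_div_exprn_le n0 e2 y_ge1 yK.
  by have := ler_distD (K / enorm y ^+ n) (U y) 0; rewrite !subr0; lra.
have ext x : rho <= N x -> U x = a * rho ^+ n / N x ^+ n.
  apply: exterior_uniqueness => // y Hy; first exact/HU/exteriorO.
  exact: (sphereO _ Hy).2.
have aK : a * rho ^+ n = K.
  apply/eqP; rewrite -subr_eq0 -normr_le0; apply/ler_addgt0Pr => e e0; rewrite add0r.
  have K1 : 0 < `|K| + 1 by rewrite ltr_wpDl.
  (* At an equidistant point the denominators cancel, leaving [|a rho^n - K|] at most
     [e |K| / (|K| + 1)]. *)
  have [M HM] := asymE _ (divr_gt0 e0 K1).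
  have [x xN] := far_equidistant r0 (Num.max M rho) (ltnW d2).
  rewrite gt_max => /andP[Mx rx].
  have Nx : rho <= N x by rewrite /N -xN ltW.
  have := HM _ (exteriorO _ Nx) Mx; rewrite ext// {1}/N -xN -mulrBl.
  have P0 : 0 < enorm x ^+ n by rewrite exprn_gt0// (lt_trans rho0).
  rewrite !normrM mulrA ler_pM2r ?normr_gt0 ?invr_eq0 ?gt_eqF// => /le_trans; apply.
  by rewrite mulrAC ler_pdivrMr// ler_wpM2l ?ltW//; lra.
pose q := r0 + (2 * rho) *: delta_mx ord0 i0.
have Nq : N q = 2 * rho by rewrite Ni// mulr_ge0// ltW.
have Oq : Omega q by apply: exteriorO; rewrite Nq; lra.
(* Were [K] zero, [U] would equal [a = 0] on the whole exterior, and [q], at distance [2 * rho],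
   would belong to the level set. *)
have K0 : K != 0.
  apply/eqP => K0; have : a * rho ^+ n == 0 by rewrite aK K0.
  rewrite mulf_eq0 (gt_eqF (exprn_gt0 _ rho0)) orbF => /eqP a0.
  have : U q = a by rewrite ext ?a0 ?mul0r// Nq; lra.
  by move=> /(levelO _ Oq); rewrite Nq; lra.
have punct x : Omega x -> x != r0 -> U x = K / N x ^+ n.
  move=> Ox xr0; apply/eqP; rewrite -subr_eq0 -mulN1r; apply/eqP.
  apply: (@punctured_domain_continuation _ _ (fun x => U x + -1 * (K * (N x ^+ n)^-1))
    Omega r0 q) => //.
    move=> y Oy yr0; apply: harmonic_atD; first exact: HU.
    by do 2 apply: harmonic_atZ; exact: harmonic_at_newtonian.
  have : \forall y \near q, rho < N y by apply: near_gt; rewrite Nq; lra.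
  by apply: filterS => y /ltW/ext->; rewrite aK mulN1r subrr.
have nO : ~ Omega r0.
  move=> Or0; pose C := `|U r0| + 1.
  have C0 : 0 < C by rewrite ltr_wpDl.
  have UC : \forall y \near r0, `|U r0 - U y| < 1.
    by have [cU _] := HU _ Or0; exact: (cvgr_dist_lt _ _ cU).
  have Onear : \forall y \near r0, Omega y by exact: open_nbhs_nbhs.
  have [e e0 He] := (nbhs_cube _ _).1 (filterI Onear UC).
  (* At distance [t] from [r0], [t <= 1] gives [|U x| >= |K| / t], and the last bound makes this at
     least [2 * C], while continuity forces [|U x| < C]. *)
  pose t := Num.min (e / 2) (Num.min 1 (`|K| / (2 * C))).
  have t0 : 0 < t.
    by rewrite !lt_min ltr01 !divr_gt0 ?normr_gt0// mulr_gt0.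
  have te : t < e.
    by apply: (@le_lt_trans _ _ (e / 2)); [rewrite ge_min lexx|lra].
  have t1 : t <= 1 by rewrite !ge_min lexx orbT.
  have tK : t <= `|K| / (2 * C) by rewrite !ge_min lexx !orbT.
  pose x := r0 + t *: delta_mx ord0 i0.
  have [|Ox Ux] := He x.
    move=> j; rewrite !mxE addrAC subrr add0r.
    by case: (_ && _); rewrite /= ?mulr1 ?mulr0 ?normr0 ?(gtr0_norm t0).
  have Nx : N x = t by rewrite Ni// ltW.
  have xr0 : x != r0 by rewrite -subr_eq0 -enorm_gt0 -/(N x) Nx.
  have : `|K| / t <= `|U x|.
    rewrite punct// Nx normrM normfV (gtr0_norm (exprn_gt0 _ t0)) ler_wpM2l//.
    by rewrite lef_pV2 ?posrE ?exprn_gt0// ler_iXnr// ltW.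
  have : 2 * C <= `|K| / t by rewrite ler_pdivlMr// mulrC -ler_pdivlMr// mulr_gt0.
  by have := ler_distD (U r0) (U x) 0; rewrite !subr0 distrC /C; move: Ux C0; rewrite /C; lra.
move=> r Or; rewrite HK; apply: punct => //.
by apply/eqP => E; apply: nO; rewrite -E.
Qed.
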